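(* With the setting of the context and $\beta\ge1$, let $\mathcal A_{mse}$ be the disk of radius $R_{mse}>0$ centered at a point on the boundary circle of $\mathcal A_\mu$, and $\mathcal A_{int}=\mathcal A_{mse}\cap\mathcal A_\mu$. Then the probability of a successful transmission originating from $\mathcal A_{int}$, i.e. $P^s_e=\mathbb E\{\sum_{\mathbf x_n\in\tilde\Psi_\mu\cap\mathcal A_{int}}\mathbb 1_{\{\mathrm{SINR}^n_\mu\ge\beta\}}\}$, is $$P^s_e=a\lambda\int_h^d\sum_{k=0}^{m-1}\frac{(-m\beta r^\eta)^k}{k!}\Big[\frac{\partial^k}{\partial s^k}\mathcal L_I(s)\Big]_{s=m\beta r^\eta}\, r\,\theta\big(\sqrt{r^2-h^2}\big)\,dr,$$ where $$\theta(w)=\begin{cases}2\pi,& 0\le w\le\max(0,R_{mse}-R),\\ 2\arccos\Big(\dfrac{R^2+w^2-R_{mse}^2}{2Rw}\Big),& |R_{mse}-R|\le w\le R_{mse}+R,\\ 0,&\text{otherwise.}\end{cases}$$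
   Context: IoT nodes on the ground plane form a homogeneous Poisson point process of intensity $\lambda>0$. A UAV hovers at altitude $h>0$ above the center $c_\mu$ of a ground disk $\mathcal A_\mu$ of radius $R>0$; $d=\sqrt{h^2+R^2}$; a ground node at $\mathbf x$ is at distance $D_{\mathbf x}=\sqrt{\|\mathbf x-c_\mu\|^2+h^2}$ from the UAV. Each node in $\mathcal A_\mu$ transmits independently with probability $a\in(0,1]$, so the transmitters $\tilde\Psi_\mu$ form a PPP of intensity $a\lambda\mathbb 1_{\{\mathbf x\in\mathcal A_\mu\}}$. Transmit power $P>0$, noise variance $\sigma_n^2>0$, path-loss exponent $\eta>2$, i.i.d. Gamma fading gains $G_{\mathbf x}$ with density $\frac{m^m g^{m-1}}{\Gamma(m)}e^{-mg}$, $m$ a positive integer. $\mathrm{SINR}^n_\mu=\frac{P G_{\mathbf x_n}D_{\mathbf x_n}^{-\eta}}{\sum_{\mathbf x\in\tilde\Psi_\mu\setminus\{\mathbf x_n\}}P G_{\mathbf x}D_{\mathbf x}^{-\eta}+\sigma_n^2}$. $\mathcal L_I(s)=e^{-s\sigma_n^2/P}\exp\big(-2\pi\lambda a\int_h^d(1-(1+\tfrac{s r^{-\eta}}{m})^{-m})r\,dr\big)$ is the Laplace transform of the normalized interference-plus-noise $I=\sum_{\mathbf x\in\tilde\Psi_\mu\setminus\{\mathbf x_n\}}G_{\mathbf x}D_{\mathbf x}^{-\eta}+\sigma_n^2/P$. *)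

(* Defs.v *)
From HB Require Import structures.
From mathcomp Require Import all_boot all_order all_algebra.
From mathcomp Require Import all_classical all_reals all_analysis.
Set Implicit Arguments. Unset Strict Implicit. Unset Printing Implicit Defensive.
Import Order.TTheory GRing.Theory Num.Theory.
Import numFieldNormedType.Exports.
Local Open Scope classical_set_scope.
Local Open Scope ring_scope.

Section Defs.
Context {R : realType}.

Definition dist2 (p q : R * R) : R :=
  Num.sqrt ((p.1 - q.1) ^+ 2 + (p.2 - q.2) ^+ 2).

Definition in_disk (c : R * R) (rad : R) (p : R * R) : bool := dist2 p c <= rad.

(* Gamma(m, 1/m) density: m^m g^(m-1) / Gamma(m) e^(-m g), Gamma(m) = (m-1)! *)
Definition gamma_pdf (m : nat) (g : R) : R :=
  if 0 < g then
    m%:R ^+ m * g ^+ (m.-1) / (m.-1)`!%:R * expR (- (m%:R * g))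
  else 0.

(* distance from ground node x to the UAV hovering at altitude h above c *)
Definition uav_dist (h : R) (c x : R * R) : R :=
  Num.sqrt (dist2 x c ^+ 2 + h ^+ 2).

(* a marked node: (position, fading gain) *)
Definition node := ((R * R) * R)%type.
Definition node0 : node := ((0, 0), 0).

Definition rx_power (P eta h : R) (c : R * R) (p : node) : R :=
  P * p.2 * (uav_dist h c p.1) `^ (- eta).

Definition SINR (P sigma2 eta h : R) (c : R * R) (pts : seq node) (n : nat) : R :=
  rx_power P eta h c (nth node0 pts n) /
  (\sum_(j < size pts | (j : nat) != n) rx_power P eta h c (nth node0 pts j)
   + sigma2).

Definition success_count (P sigma2 eta h beta : R) (cmu : R * R) (Rad : R)
    (cmse : R * R) (Rmse : R) (pts : seq node) : R :=
  \sum_(n < size pts)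
    ([&& in_disk cmse Rmse (nth node0 pts n).1,
         in_disk cmu Rad (nth node0 pts n).1 &
         beta <= SINR P sigma2 eta h cmu pts n])%:R.

Fixpoint iterint (N : nat) (F : seq node -> \bar R) : \bar R :=
  match N with
  | 0 => F [::]
  | N'.+1 =>
      (\int[lebesgue_measure]_(x1 in setT)
        \int[lebesgue_measure]_(x2 in setT)
          \int[lebesgue_measure]_(g in setT)
            iterint N' (fun s => F (((x1, x2), g) :: s)))%E
  end.

(* Expectation of F(Psi) for Psi a Poisson point process on the plane of
   intensity  intensity * 1_{disk(c, rad)}, independently marked with i.i.d.
   Gamma(m,1/m) fading gains (Janossy-density representation of a PPP with
   finite intensity measure Lambda = intensity * pi * rad^2). *)
Definition ppp_disk_expect (intensity : R) (c : R * R) (rad : R) (m : nat)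
    (F : seq node -> R) : \bar R :=
  (\sum_(N <oo)
     ((expR (- (intensity * pi * rad ^+ 2)) / N`!%:R)%:E *
      iterint N (fun s =>
        ((\prod_(p <- s) (intensity * (in_disk c rad p.1)%:R * gamma_pdf m p.2))
         * F s)%:E)))%E.

(* Laplace transform L_I(s) of the normalized interference-plus-noise *)
Definition LI (lam a P sigma2 eta h d : R) (m : nat) (s : R) : R :=
  expR (- (s * sigma2 / P)) *
  expR (- (2 * pi * lam * a *
    \int[lebesgue_measure]_(r in `[h, d])
       ((1 - ((1 + s * r `^ (- eta) / m%:R) ^+ m)^-1) * r))).

Definition theta (Rad Rmse : R) (w : R) : R :=
  if (0 <= w) && (w <= Num.max 0 (Rmse - Rad)) then 2 * pi
  else if (`|Rmse - Rad| <= w) && (w <= Rmse + Rad) then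
    2 * acos ((Rad ^+ 2 + w ^+ 2 - Rmse ^+ 2) / (2 * Rad * w))
  else 0.

End Defs.

(* Main.v *)
(** Write [mu3] for Lebesgue measure on marked nodes (position, gain) and [w] for
the intensity of the marked transmitters. The received powers of [N] nodes add up to
a variable whose law, weighted by the product of the [w]'s, is the [N]-fold convolution
[rho N] of the image of [w . mu3] under the received power. Singling out one node at a
time (Tonelli and the symmetry of the product) shows that the [N]-th Janossy term of
the expected number of successes is [N] times the integral of
[Psi y = int w(p) 1{p succeeds against interference y}] against [rho (N-1)]; summing
over [N], the expectation is the integral of [Psi] against the Poisson mixture of the
[rho N], which is the law of the interference.

The Erlang tail [P(G >= t) = sum_(k < m) (m t)^k / k! e^(- m t)] turns [Psi] into a
combination of [I^k e^(- s I)], whose means are, up to sign, the derivatives of the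
Laplace transform of the interference. That transform is [exp] of a radial integral,
and both this integral and the integral over the lens are reduced to the distance to
the UAV by polar coordinates, where [theta] is the angle under which the circle of
radius [w] meets the second disk. *)

Require Import Defs.
From HB Require Import structures.
From mathcomp Require Import all_boot all_order all_algebra.
From mathcomp Require Import all_classical all_reals all_analysis.
From mathcomp Require Import measurable_realfun lebesgue_integral_under ring lra.
Import Order.TTheory GRing.Theory Num.Theory.
Import numFieldNormedType.Exports.
Local Open Scope classical_set_scope.
Local Open Scope ring_scope.

Set Implicit Arguments.
Unset Strict Implicit.
Unset Printing Implicit Defensive.

(** * Changes of variables for Lebesgue measure *)

(** Cancelling the factor [N] against [N!] and shifting the index turns the Janossy series into the
    same Poisson mixture that describes the total received power: this is the Slivnyak-Mecke
    theorem, that a node of a Poisson process sees the others as an unconditioned copy of the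
    process. The mixture is never computed. It is an abstract finite measure on the line known
    through three facts: its Laplace transform, its concentration on the nonnegative half-line, and
    the mean formula. Concentration matters because differentiating under the integral needs the
    bound [x^k e^(- s x) <= k! / s^k], valid for [x >= 0]. Noise is kept out of the mixture; it
    enters through [v y = (y + sigma2) / P]. Nonnegativity of the integrands lets Tonelli justify
    the exchanges of integrals with no integrability check, and changes of variables are reduced to
    the uniqueness of Lebesgue measure. *)

Section weighted_pushforward.
Local Open Scope ereal_scope.
Context d d' (T : measurableType d) (T' : measurableType d') (R : realType).
Variables (mu : {measure set T -> \bar R}) (w : T -> R) (phi : T -> T').
Hypothesis w0 : forall x, (0 <= w x)%R.
Hypothesis mw : measurable_fun [set: T] w.
Hypothesis mphi : measurable_fun [set: T] phi.

Let nu (A : set T') : \bar R := \int[mu]_(x in phi @^-1` A) (w x)%:E.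

Let mpre A : measurable A -> measurable (phi @^-1` A).
Proof. by move=> mA; rewrite -[X in measurable X]setTI; exact: mphi. Qed.

Let nu0 : nu set0 = 0.
Proof. by rewrite /nu preimage_set0 integral_set0. Qed.

Let nu_ge0 A : 0 <= nu A.
Proof. by apply: integral_ge0 => x _; rewrite lee_fin. Qed.

Let nu_sigma_additive : semi_sigma_additive nu.
Proof.
move=> /= F mF tF mUF; rewrite /nu; apply: cvg_toP.
  apply: ereal_nondecreasing_is_cvgn => m n mn.
  apply: lee_sum_nneg_natr => // k _ _; apply: integral_ge0 => /= x Fkx.
  by rewrite lee_fin.
rewrite preimage_bigcup ge0_integral_bigcup//=.
- by move=> n; exact: mpre.
- by apply/measurable_EFinP; exact: measurable_funTS.
- by move=> x _; rewrite lee_fin.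
- apply/trivIsetP => /= i j _ _ ij; rewrite -preimage_setI.
  by move/trivIsetP : tF => /(_ _ _ _ _ ij) ->//; rewrite preimage_set0.
Qed.

HB.instance Definition _ := isMeasure.Build _ _ _ nu nu0 nu_ge0 nu_sigma_additive.

Import HBNNSimple.

Let nu_nnsfun (f : {nnsfun T' >-> R}) :
  \int[nu]_y (f y)%:E = \int[mu]_x ((w x)%:E * (f (phi x))%:E).
Proof.
under [LHS]eq_integral do rewrite fimfunE -fsumEFin//.
rewrite ge0_integral_fsum//; last 2 first.
  - by move=> r /=; apply: measurableT_comp => //; exact: measurableT_comp.
  - by move=> r t _; rewrite EFinM nnfun_muleindic_ge0.
under [RHS]eq_integral.
  move=> x _; rewrite (fimfunE f) -fsumEFin// ge0_mule_fsumr; last first.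
    by move=> r; rewrite EFinM nnfun_muleindic_ge0.
  over.
rewrite ge0_integral_fsum//; last 2 first.
  - move=> r; apply: emeasurable_funM; first exact/measurable_EFinP.
    apply/measurable_EFinP; apply: measurable_funM => //.
    exact: (@measurableT_comp _ _ _ _ _ _ (\1_(f @^-1` [set r]) : T' -> R)).
  - move=> r x _; apply: mule_ge0; first by rewrite lee_fin.
    by rewrite EFinM nnfun_muleindic_ge0.
apply: eq_fsbigr => r; rewrite inE => -[z _ <-].
have fz0 : (0 <= f z)%R by [].
rewrite integralZl_indic_nnsfun//= integral_indic// setIT.
have mp : measurable (phi @^-1` (f @^-1` [set f z])) by exact: mpre.
rewrite /nu/= -ge0_integralZl_EFin//; last 2 first.
- by move=> x _; rewrite lee_fin.
- by apply/measurable_EFinP; exact: measurable_funTS.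
rewrite integral_mkcond; apply: eq_integral => x _.
rewrite patchE indicE.
have -> : (phi x \in f @^-1` [set f z]) = (x \in phi @^-1` (f @^-1` [set f z])).
  by apply/idP/idP; rewrite !inE.
by case: ifP => _; rewrite ?mulr1 ?mulr0 ?mule0// muleC.
Qed.

(** The image under [phi] of the measure of density [w]. The integral formula holds for simple
    functions by linearity and passes to the limit by monotone convergence on both sides. *)
Lemma weighted_pushforward_exists : exists2 nu : {measure set T' -> \bar R},
  forall A, nu A = \int[mu]_(x in phi @^-1` A) (w x)%:E &
  forall H, measurable_fun [set: T'] H -> (forall y, 0 <= H y) ->
    \int[nu]_y H y = \int[mu]_x ((w x)%:E * H (phi x)).
Proof.
exists nu => // H mH H0.
pose f_ := nnsfun_approx measurableT mH.
transitivity (limn (fun n => \int[nu]_x (f_ n x)%:E)).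
  rewrite -monotone_convergence//.
  - apply: eq_integral => y _; apply/esym/cvg_lim => //.
    exact: cvg_nnsfun_approx.
  - by move=> n; exact/measurable_EFinP/measurable_funP.
  - by move=> n y _; rewrite lee_fin.
  - by move=> y _ m n mn; rewrite lee_fin; exact/lefP/nd_nnsfun_approx.
under eq_fun do rewrite nu_nnsfun.
rewrite -monotone_convergence//; last 3 first.
  - move=> n; apply: emeasurable_funM; apply/measurable_EFinP => //.
    exact: measurableT_comp.
  - by move=> n x _; rewrite mule_ge0// lee_fin.
  - move=> x _ m n mn; rewrite lee_wpmul2l ?lee_fin//.
    exact/lefP/nd_nnsfun_approx.
apply: eq_integral => x _; apply/cvg_lim => //.
by apply: cvgeZl => //; apply: cvg_nnsfun_approx.
Qed.

End weighted_pushforward.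

Section lebesgue_affine.
Local Open Scope ereal_scope.
Context (R : realType).
Notation mu := (@lebesgue_measure R).

(** Half-open intervals determine Lebesgue measure. When the end points are out of order the
    interval is empty, so [a <= b] is the only case to ask for. *)
Lemma eq_lebesgue_functional (nu : {measure set (measurableTypeR R) -> \bar R}) :
  (forall a b : R, (a <= b)%R -> nu `]a, b]%classic = (b - a)%:E) ->
  forall H : R -> \bar R, \int[nu]_x H x = \int[mu]_x H x.
Proof.
move=> nuE H.
apply: eq_measure_integral => A mA _; apply/esym; apply: lebesgue_measure_unique => //.
move=> _ [[a b] _ <-] /=.
have [ab|ba] := leP a b.
  by rewrite nuE// lebesgue_measure_itv/= lte_fin; case: ltgtP ab => // -> _; rewrite subrr.
by rewrite set_itv_ge ?measure0// bnd_simp -leNgt ltW.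
Qed.

(** A substitution rule that asks neither for a derivative nor for bijectivity: it suffices to weigh
    preimages of intervals, since then [phi] carries [w dx] to Lebesgue measure. *)
Lemma ge0_integral_lebesgue_change (w phi : R -> R) (H : R -> \bar R) :
  (forall x, (0 <= w x)%R) -> measurable_fun [set: R] w ->
  measurable_fun [set: R] phi ->
  (forall a b : R, (a <= b)%R ->
    \int[mu]_(x in phi @^-1` `]a, b]%classic) (w x)%:E = (b - a)%:E) ->
  measurable_fun [set: R] H -> (forall y, 0 <= H y) ->
  \int[mu]_x ((w x)%:E * H (phi x)) = \int[mu]_x H x.
Proof.
move=> w0 mw mphi wphi mH H0.
have [nu nuA nuE] := @weighted_pushforward_exists _ _ (measurableTypeR R)
  (measurableTypeR R) R mu w phi w0 mw mphi.
rewrite -(@eq_lebesgue_functional nu _ H) ?nuE// => a b ab.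
by rewrite nuA wphi.
Qed.

Lemma ge0_integral_affine (H : R -> \bar R) (a b : R) : a != 0%R ->
  measurable_fun [set: R] H -> (forall y, 0 <= H y) ->
  `|a|%:E * \int[mu]_x H (a * x + b)%R = \int[mu]_x H x.
Proof.
move=> a0 mH H0.
have mphi : measurable_fun [set: R] (fun x : R => a * x + b)%R.
  by apply: measurable_funD => //; exact: measurable_funM.
rewrite -ge0_integralZl//; last exact: measurableT_comp.
apply: (@ge0_integral_lebesgue_change (cst `|a|%R)) => //= u v uv.
have [a_gt0|a_lt0] := ltP 0%R a; last have {a_lt0}a_lt0 : (a < 0)%R by rewrite lt_neqAle a0.
- have -> : (fun x : R => a * x + b)%R @^-1` `]u, v]%classic =
      `]((u - b) / a)%R, ((v - b) / a)%R]%classic.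
    apply/seteqP; split => x /=; rewrite !in_itv/= => /andP[ux xv];
      apply/andP; split; move: ux xv; rewrite ?ltr_pdivrMr ?ler_pdivlMr ?ltrBlDr ?lerBrDr// mulrC//.
  rewrite integral_cst//= lebesgue_measure_itv/= lte_fin ltr_pM2r ?invr_gt0// ltrD2r.
  case: ltgtP uv => // [uv _|-> _]; last by rewrite mule0 subrr.
  rewrite -EFinD -EFinM gtr0_norm//; congr EFin; field.
  exact: lt0r_neq0.
- have -> : (fun x : R => a * x + b)%R @^-1` `]u, v]%classic =
      `[((v - b) / a)%R, ((u - b) / a)%R[%classic.
    apply/seteqP; split => x /=; rewrite !in_itv/= => /andP[ux xv];
      apply/andP; split; move: ux xv; rewrite ?ltr_ndivlMr ?ler_ndivrMr ?ltrBlDr ?lerBrDr// mulrC//.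
  rewrite integral_cst//= lebesgue_measure_itv/= lte_fin ltr_nM2r ?invr_lt0// ltrD2r.
  case: ltgtP uv => // [uv _|-> _]; last by rewrite mule0 subrr.
  rewrite -EFinD -EFinM ltr0_norm//; congr EFin; field.
  by rewrite lt_eqF.
Qed.

Local Close Scope ereal_scope.

Lemma is_derive_mulr_normr (x : R) :
  is_derive x 1%R (fun x : R => x * `|x| / 2)%R `|x|%R.
Proof.
have [x0|x0|->] := ltgtP x 0%R.
- have h : is_derive x 1%R (fun x : R => - (x ^+ 2 / 2))%R `|x|%R.
    by apply: is_derive_eq; rewrite ltr0_norm// /GRing.scale/=; field.
  apply: near_eq_is_derive h.
  near=> y; have y0 : y < 0 by near: y; exact: lt_nbhsl.
  by rewrite ltr0_norm//; field.
- have h : is_derive x 1%R (fun x : R => (x ^+ 2 / 2))%R `|x|%R.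
    by apply: is_derive_eq; rewrite gtr0_norm// /GRing.scale/=; field.
  apply: near_eq_is_derive h.
  near=> y; have y0 : 0 < y by near: y; exact: lt_nbhsr.
  by rewrite gtr0_norm//; field.
(* At 0 the two quadratic branches meet and neither covers a neighbourhood; the difference quotient
   is [|h| / 2], which tends to 0. *)
- have h : (fun h : R => h^-1 *: (((h *: (1:R) + 0) * `|h *: (1:R) + 0| / 2) - (0:R) * `|0:R| / 2)) @ (0:R)^' --> `|0:R|.
    have : (fun h : R => `|h| / 2) @ (0:R)^' --> `|0:R|.
      have -> : `|0:R| = `|0:R| / 2 by rewrite normr0 mul0r.
      apply: cvg_within_filter; apply: cvgM; last exact: cvg_cst.
      exact: norm_continuous.
    apply: cvg_trans; apply: near_eq_cvg; near=> h.
    have h0 : h != 0 by near: h; exact: nbhs_dnbhs_neq.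
    by rewrite /GRing.scale/= mulr1 addr0 !mul0r subr0; field.
  apply: DeriveDef.
    by apply/cvg_ex; exists `|0:R|; exact: h.
  exact/cvg_lim.
Unshelve. all: end_near. Qed.

Local Open Scope ereal_scope.

(* [x |x| / 2] is the increasing bijection of [R] that carries [|x| dx] to [dx]. *)
Lemma ge0_integral_half_square (H : R -> \bar R) :
  measurable_fun [set: R] H -> (forall y, 0 <= H y) ->
  \int[mu]_x (`|x|%:E * H (x * `|x| / 2)%R) = \int[mu]_x H x.
Proof.
move=> mH H0.
have mphi : measurable_fun [set: R] (fun x : R => x * `|x| / 2)%R.
  by apply: measurable_funM => //; apply: measurable_funM => //; exact: normr_measurable.
apply: (@ge0_integral_lebesgue_change (fun x => `|x|%R) _ _ _ _ mphi) => //= a b ab.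
(* The inverse of [x |x| / 2], which gives the end points of the preimage of an interval. *)
pose s (y : R) := (Num.sg y * Num.sqrt (2 * `|y|))%R.
have sK y : (s y * `|s y| / 2 = y)%R.
  rewrite /s normrM normr_sg (ger0_norm (sqrtr_ge0 _)).
  have [->|y0] := eqVneq y 0%R; first by rewrite sgr0 !mul0r.
  set q := Num.sqrt _; have q2 : (q * q = 2 * `|y|)%R.
    by rewrite -expr2 sqr_sqrtr// mulr_ge0.
  transitivity (Num.sg y * (q * q) / 2)%R; first by rewrite /= ?mulr1n; ring.
  by rewrite q2 [RHS]numEsg; field.
have mono (x y : R) : (x < y -> x * `|x| / 2 < y * `|y| / 2)%R.
  move=> xy; rewrite ltr_pM2r//.
  have [x0|x0] := leP 0%R x.
    rewrite !ger0_norm// ?(le_trans x0 (ltW xy))//.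
    nra.
  rewrite (ltr0_norm x0); have [y0|y0] := leP 0%R y.
    rewrite ger0_norm//; nra.
  rewrite ltr0_norm//; nra.
have monoW : {mono (fun x : R => x * `|x| / 2)%R : x y / (x < y)%R}.
  apply: leW_mono; apply: le_mono => x y; exact: mono.
have monoL : {mono (fun x : R => x * `|x| / 2)%R : x y / (x <= y)%R}.
  by apply: le_mono => x y; exact: mono.
have -> : (fun x : R => x * `|x| / 2)%R @^-1` `]a, b]%classic = `]s a, s b]%classic.
  apply/seteqP; split => x /=;
    by rewrite !in_itv/= -(monoW (s a)) -(monoL x (s b)) !sK.
move: ab; rewrite le_eqVlt => /predU1P[<-|ab].
  by rewrite set_itv_ge ?bnd_simp ?ltxx// integral_set0 subrr.
rewrite integral_itv_obnd_cbnd//; last first.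
  by apply/measurable_EFinP; apply: measurable_funTS; exact: normr_measurable.
rewrite (@continuous_FTC2 _ _ (fun x => x * `|x| / 2)%R).
- by rewrite -EFinB !sK.
- by rewrite -monoW !sK.
- by apply: continuous_subspaceT => x; exact: norm_continuous.
- have cv x : {for x, continuous (fun x : R => x * `|x| / 2)%R}.
    by apply: differentiable_continuous; apply/derivable1_diffP; have [] := is_derive_mulr_normr x.
  split.
  + by move=> x _; have [] := is_derive_mulr_normr x.
  + by apply: cvg_at_right_filter; exact: cv.
  + by apply: cvg_at_left_filter; exact: cv.
- by move=> x _; rewrite derive1E; exact: @derive_val _ _ _ _ _ _ _ (is_derive_mulr_normr x).
Qed.

End lebesgue_affine.

(** * Polar coordinates *)

Section angle.
Context (R : realType).
Notation mu := (@lebesgue_measure R).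
Implicit Types (k t : R).

(* The measure of the half-circle angles whose cosine is at least [k]. *)
Definition sector_angle k : R := if k <= -1 then pi else if 1 <= k then 0 else acos k.

Lemma sqrt_oneDsqr_gt t : `|t| < Num.sqrt (1 + t ^+ 2).
Proof. by have := sqr_ge0 t => t2; rewrite -sqrtr_sqr ltr_sqrt; lra. Qed.

Lemma sqrt_oneDsqr_sin_atan t : sin (atan t) = t / Num.sqrt (1 + t ^+ 2).
Proof.
have c0 : 0 < Num.sqrt (1 + t ^+ 2) by apply: le_lt_trans (sqrt_oneDsqr_gt t).
have ct : cos (atan t) != 0 by rewrite cos_atan invr_neq0// gt_eqF.
rewrite -cos_atan; apply: (mulIf (invr_neq0 ct)); rewrite mulfK//.
exact: atanK.
Qed.

(** Since [sin (atan t) = t / sqrt (1 + t^2)], the condition is [k <= sin (atan t)], and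
    [dt / (1 + t^2)] is the differential of [atan t]. Strictness of [|t| < sqrt (1 + t^2)] settles
    the cases [k <= -1] and [1 <= k]. *)
Lemma integral_sector_angle k :
  (\int[mu]_t ((1 + t ^+ 2)^-1 * (k * Num.sqrt (1 + t ^+ 2) <= t)%R%:R)%R%:E =
   (sector_angle k)%:E)%E.
Proof.
have q0 t : 0 < Num.sqrt (1 + t ^+ 2) by apply: le_lt_trans (sqrt_oneDsqr_gt t).
rewrite /sector_angle; case: ifPn => [k1|]; last rewrite -ltNge => k1.
  under eq_integral.
    move=> t _; have -> : k * Num.sqrt (1 + t ^+ 2) <= t.
      have := sqrt_oneDsqr_gt t; have := q0 t; rewrite ltr_norml => q1 /andP[t1 t2].
      nra.
    rewrite mulr1; over.
  rewrite (@ge0_symfun_integralT _ (fun t => (1 + t ^+ 2)^-1)); last 3 first.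
  - by move=> x; rewrite invr_ge0 addr_ge0// sqr_ge0.
  - exact: continuous_oneDsqrV.
  - by move=> x /=; rewrite sqrrN.
  rewrite (_ : [set x | _] = `[0, +oo[%classic); last first.
    by apply/seteqP; split => x/=; rewrite in_itv/= andbT.
  by rewrite integral0y_oneDsqr -EFinM; congr EFin; field.
case: ifPn => [k2|]; last rewrite -ltNge => k2.
  rewrite integral0_eq// => t _; suff -> : (k * Num.sqrt (1 + t ^+ 2) <= t) = false.
    by rewrite mulr0.
  apply/negbTE; rewrite -ltNge.
  have := sqrt_oneDsqr_gt t; have := q0 t; rewrite ltr_norml => q1 /andP[t1 t2].
  nra.
(* This is the arcsine of [k], the value of [atan t] from which the condition holds. *)
pose al : R := pi / 2 - acos k.
have kk : -1 <= k <= 1 by rewrite !ltW.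
have a0 : 0 < acos k by apply: acos_gt0; rewrite (ltW k1).
have api : acos k < pi by apply: acos_ltpi; rewrite k1 ltW.
have alI : al \in `](- (pi / 2)), (pi / 2)[.
  by rewrite in_itv/= /al; apply/andP; split; lra.
have E t : (k * Num.sqrt (1 + t ^+ 2) <= t) = (tan al <= t).
  rewrite -ler_pdivlMr// -sqrt_oneDsqr_sin_atan.
  have -> : sin (atan t) = cos (pi / 2 - atan t).
    by rewrite cosB cos_pihalf sin_pihalf mul0r mul1r add0r.
  have := atan_gtNpi2 t; have := atan_ltpi2 t => t1 t2.
  rewrite -[in LHS](@acosK _ k) ?in_itv//=.
  have -> : (cos (acos k) <= cos (pi / 2 - atan t)) = (pi / 2 - atan t <= acos k).
    rewrite !leNgt ltr_cos// ?in_itv/= ?acos_ge0 ?acos_lepi//.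
    by apply/andP; split; lra.
  have -> : (pi / 2 - atan t <= acos k) = (al <= atan t).
    by rewrite /al; apply/idP/idP => ?; lra.
  apply/idP/idP => [|h].
    rewrite -{1}(tanK alI) => h; rewrite leNgt; apply/negP => /lt_atan.
    by rewrite ltNge h.
  by rewrite -(tanK alI) le_atan.
under eq_integral do rewrite E.
rewrite (_ : acos k = pi / 2 - atan (tan al)); last by rewrite tanK// /al; lra.
rewrite EFinB -(@ge0_continuous_FTC2y _ (fun t => (1 + t ^+ 2)^-1)) //.
- rewrite [RHS]integral_mkcond; apply: eq_integral => t _; rewrite patchE mem_setE in_itv/= andbT.
  by case: ifP; rewrite ?mulr1 ?mulr0.
- by move=> x _; rewrite invr_ge0 addr_ge0// sqr_ge0.
- by apply: continuous_subspaceT; exact: continuous_oneDsqrV.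
- exact: cvgy_atan.
- by apply: cvg_at_right_filter; exact: continuous_atan.
- by move=> x _; exact: derive1_atan.
Qed.

End angle.

Section planar.
Local Open Scope ereal_scope.
Context (R : realType).
Notation mu := (@lebesgue_measure R).

Let mpair d (T : measurableType d) (f g : T -> R) (G : R * R -> \bar R) :
  measurable_fun setT G -> measurable_fun setT f -> measurable_fun setT g ->
  measurable_fun setT (fun x => G (f x, g x)).
Proof.
move=> mG mf mg; apply: (@measurableT_comp _ _ _ _ _ _ G) => //.
exact: measurable_fun_pair.
Qed.

Lemma lebesgue_tonelli (F : R -> R -> \bar R) :
  measurable_fun setT (fun p : R * R => F p.1 p.2) -> (forall x y, 0 <= F x y) ->
  \int[mu]_x \int[mu]_y F x y = \int[mu]_y \int[mu]_x F x y.
Proof.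
move=> mF F0.
exact: (@fubini_tonelli _ _ (measurableTypeR R) (measurableTypeR R) R mu mu
  (fun p => F p.1 p.2) mF (fun p => F0 p.1 p.2)).
Qed.

Lemma measurable_lebesgue_integral (F : R -> R -> \bar R) :
  measurable_fun setT (fun p : R * R => F p.1 p.2) -> (forall x y, 0 <= F x y) ->
  measurable_fun setT (fun x => \int[mu]_y F x y).
Proof.
move=> mF F0.
exact: (@measurable_fun_fubini_tonelli_F _ _ (measurableTypeR R) (measurableTypeR R) R mu
  (fun p => F p.1 p.2) mF (fun p => F0 p.1 p.2)).
Qed.

(* Triangular factorisation: one affine substitution per coordinate when [e1 != 0],
   and a swap of the coordinates when [e1 = 0]. *)
Lemma ge0_integral_rotation (G : R * R -> \bar R) (c1 c2 e1 e2 : R) :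
  measurable_fun setT G -> (forall p, 0 <= G p) ->
  (e1 ^+ 2 + e2 ^+ 2 = 1)%R ->
  \int[mu]_u \int[mu]_v G (e1 * u - e2 * v + c1, e2 * u + e1 * v + c2)%R =
  \int[mu]_x \int[mu]_y G (x, y).
Proof.
move=> mG G0 e12.
have m1 (a b c : R) : measurable_fun setT (fun p : R * R => a * p.1 + b * p.2 + c)%R.
  by apply: measurable_funD => //; apply: measurable_funD; apply: measurable_funM.
have m2 (a b : R) : measurable_fun setT (fun x : R => a * x + b)%R.
  by apply: measurable_funD => //; apply: measurable_funM.
have [e10|e10] := eqVneq e1 0%R.
  have n2 : `|e2|%R = 1%R.
    apply/eqP; rewrite -sqrp_eq1// -normrX ger0_norm ?sqr_ge0//.
    by move: e12; rewrite e10 expr0n/= add0r => ->.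
  have e20 : e2 != 0%R by rewrite -normr_eq0 n2 oner_eq0.
  transitivity (\int[mu]_u \int[mu]_x G (x, e2 * u + c2)%R).
    apply: eq_integral => u _; rewrite e10.
    rewrite -(@ge0_integral_affine _ (fun x => G (x, e2 * u + c2)%R) (- e2) c1) ?oppr_eq0//; last first.
      by apply: mpair => //; exact: measurable_cst.
    rewrite normrN n2 mul1e; apply: eq_integral => v _; congr (G (_, _)); ring.
  rewrite (@lebesgue_tonelli (fun u x => G (x, e2 * u + c2)%R))//; last first.
    apply: mpair => //; exact: (measurableT_comp (m2 e2 c2)).
  apply: eq_integral => x _.
  rewrite -(@ge0_integral_affine _ (fun y => G (x, y)) e2 c2)// ?n2 ?mul1e//.
  exact: mpair.
rewrite (@lebesgue_tonelli (fun u v => G (e1 * u - e2 * v + c1, e2 * u + e1 * v + c2)%R))//; last first.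
  apply: mpair => //; apply: measurable_funD => //.
  by apply: measurable_funB; apply: measurable_funM.
(* For fixed [v], [x] replaces [u]; because [e1^2 + e2^2 = 1] the second coordinate becomes [v / e1]
   plus a function of [x]. The factor [|e1|^-1] produced here is exactly the one that the later
   substitution from [v] to [y] absorbs. *)
pose K v x := G (x, e1^-1 * v + (e2 / e1 * (x - c1) + c2))%R.
have mK : measurable_fun setT (fun p : R * R => K p.1 p.2).
  apply: mpair => //.
  apply: measurable_funD; first exact: measurable_funM.
  apply: measurable_funD => //; apply: measurable_funM => //; exact: measurable_funB.
have mKv v : measurable_fun setT (K v) by exact: (measurable_fun_pair2 v mK).
have K0 v x : 0 <= K v x by exact: G0.
transitivity (\int[mu]_v ((`|e1|^-1)%:E * \int[mu]_x K v x)).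
  apply: eq_integral => v _.
  rewrite -(@ge0_integral_affine _ (K v) e1 (c1 - e2 * v))//.
  rewrite muleA -EFinM mulVf ?normr_eq0// mul1e.
  apply: eq_integral => u _; rewrite /K; congr (G (_, _)); first ring.
  transitivity (e1^-1 * ((e1 ^+ 2 + e2 ^+ 2) * v) +
    (e2 / e1 * (e1 * u + (c1 - e2 * v) - c1) + c2))%R; first by field.
  by rewrite e12 mul1r.
transitivity (\int[mu]_v \int[mu]_x ((`|e1|^-1)%:E * K v x)).
  apply: eq_integral => v _; rewrite ge0_integralZl_EFin ?invr_ge0//.
  exact: mKv.
rewrite lebesgue_tonelli; last 2 first.
- exact: emeasurable_funM.
- by move=> v x; rewrite mule_ge0// lee_fin invr_ge0.
apply: eq_integral => x _.
rewrite -(@ge0_integral_affine _ (fun y => G (x, y)) e1^-1 (e2 / e1 * (x - c1) + c2))//; last 2 first.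
- by rewrite invr_eq0.
- exact: mpair.
rewrite ge0_integralZl_EFin ?invr_ge0 ?normfV//.
by apply: mpair => //; exact: m2.
Qed.

Lemma measurable_boolr_EFin d (T : measurableType d) (b : T -> bool) :
  measurable_fun setT b -> measurable_fun setT (fun x => (b x)%:R%:E : \bar R).
Proof.
move=> mb; have -> : (fun x => (b x)%:R%:E) = (fun x => if b x then 1 else 0 : \bar R).
  by apply/funext => x; case: (b x).
exact: measurable_fun_ifT.
Qed.

Lemma measurable_sqrtr : measurable_fun [set: R] (@Num.sqrt R).
Proof. by apply: continuous_measurable_fun; exact: sqrt_continuous. Qed.

(* Only affine substitutions are needed: [x = |y| t] on each horizontal line, then
   [y = v / sqrt (1 + t^2)] for fixed [t]; the angle is measured by [dt / (1 + t^2)]. *)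
Lemma ge0_integral_polar (f : R -> \bar R) (k : R -> R) :
  measurable_fun setT f -> measurable_fun setT k -> (forall w, 0 <= f w) ->
  \int[mu]_x \int[mu]_y
    (f (Num.sqrt (x ^+ 2 + y ^+ 2))%R *
     (k (Num.sqrt (x ^+ 2 + y ^+ 2)) <= x)%R%:R%:E) =
  \int[mu]_v (`|v|%:E * (f `|v|%R * (sector_angle (k `|v| / `|v|)%R)%:E)).
Proof.
move=> mf mk f0.
pose ind (b : bool) : \bar R := b%:R%:E.
have ind0 b : 0 <= ind b by rewrite lee_fin.
have mn : measurable_fun setT (fun x : R => `|x|%R) by exact: normr_measurable.
have mfi d (T : measurableType d) (a b c : T -> R) :
    measurable_fun setT a -> measurable_fun setT b -> measurable_fun setT c ->
    measurable_fun setT (fun z => f (a z) * ind (k (a z) * b z <= c z)%R).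
  move=> ma mb mc; apply: emeasurable_funM; first exact: (measurableT_comp mf).
  apply: measurable_boolr_EFin; apply: measurable_fun_ler => //.
  by apply: measurable_funM => //; exact: (measurableT_comp mk).
pose q t : R := Num.sqrt (1 + t ^+ 2).
have mq : measurable_fun setT q.
  apply: (measurableT_comp measurable_sqrtr); apply: measurable_funD => //.
have q0 t : (0 < q t)%R by apply: le_lt_trans (sqrt_oneDsqr_gt t).
have q2 t : (q t * q t = 1 + t ^+ 2)%R by rewrite -expr2 sqr_sqrtr// addr_ge0 ?sqr_ge0.
pose A (x y : R) := f (Num.sqrt (x ^+ 2 + y ^+ 2))%R *
  ind (k (Num.sqrt (x ^+ 2 + y ^+ 2)) <= x)%R.
have msq d (T : measurableType d) (a b : T -> R) :
    measurable_fun setT a -> measurable_fun setT b ->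
    measurable_fun setT (fun z => Num.sqrt (a z ^+ 2 + b z ^+ 2))%R.
  move=> ma mb; apply: (measurableT_comp measurable_sqrtr).
  by apply: measurable_funD; exact: measurable_funX.
have mA d (T : measurableType d) (a b : T -> R) :
    measurable_fun setT a -> measurable_fun setT b ->
    measurable_fun setT (fun z => A (a z) (b z)).
  move=> ma mb; have := @mfi _ T _ (cst 1%R) a (msq _ _ _ _ ma mb) (measurable_cst _) ma.
  by under eq_fun do rewrite mulr1.
have A0 x y : 0 <= A x y by rewrite mule_ge0.
rewrite (@lebesgue_tonelli A)//; last exact: mA.
pose B (y t : R) := `|y|%:E * (f (`|y| * q t)%R * ind (k (`|y| * q t) <= `|y| * t)%R).
have mB : measurable_fun setT (fun p : R * R => B p.1 p.2).
  have mq2 : measurable_fun setT (fun p : R * R => q p.2) by exact: (measurableT_comp mq).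
  have mn1 : measurable_fun setT (fun p : R * R => `|p.1|%R) by exact: (measurableT_comp mn).
  apply: emeasurable_funM; first by apply/measurable_EFinP.
  have mp : measurable_fun setT (fun p : R * R => `|p.1| * q p.2)%R by apply: measurable_funM.
  have mp' : measurable_fun setT (fun p : R * R => `|p.1| * p.2)%R by apply: measurable_funM.
  have := @mfi _ (R * R)%type _ (cst 1%R) _ mp (measurable_cst _) mp'.
  by under eq_fun do rewrite mulr1.
have B0 y t : 0 <= B y t by rewrite mule_ge0// mule_ge0.
transitivity (\int[mu]_y \int[mu]_t B y t).
  (* The substitution [x = |y| t] needs [y != 0], so this null set is removed from both outer
     integrals. *)
  have mT0 : measurable ([set: R] `\ 0%R) by exact: measurableD.
  have D1 (h : R -> \bar R) : measurable_fun setT h ->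
      \int[mu]_x h x = \int[mu]_(x in [set: R] `\ 0%R) h x.
    by move=> mh; rewrite integral_setD1//; exact: measurable_funTS.
  rewrite D1; last first.
    by apply: (@measurable_lebesgue_integral (fun y x => A x y)) => //; exact: mA.
  rewrite [RHS]D1; last exact: measurable_lebesgue_integral.
  apply: eq_integral => y; rewrite inE /= => -[_ /eqP y0].
  have yy : (0 < `|y|)%R by rewrite normr_gt0.
  rewrite -(@ge0_integral_affine _ (A^~ y) `|y|%R 0%R) ?normr_eq0//; last exact: mA.
  rewrite -ge0_integralZl_EFin//; last first.
    apply: (mA _ R (fun t => `|y| * t + 0)%R (cst y)) => //.
    by apply: measurable_funD => //; exact: measurable_funM.
  apply: eq_integral => t _; rewrite normr_id /B /A addr0.
  have -> : (Num.sqrt ((`|y| * t) ^+ 2 + y ^+ 2) = `|y| * q t)%R.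
    rewrite -(sqrtr_sqr y) -sqrtrM ?sqr_ge0//; congr Num.sqrt.
    by rewrite exprMn sqrtr_sqr real_normK ?num_real//; ring.
  by [].
rewrite (@lebesgue_tonelli B)//.
pose C (t v : R) := (1 + t ^+ 2)^-1%:E * (`|v|%:E * (f `|v|%R * ind (k `|v| * q t <= `|v| * t)%R)).
have C0 t v : 0 <= C t v.
  by rewrite !mule_ge0// lee_fin invr_ge0 addr_ge0// sqr_ge0.
have mC : measurable_fun setT (fun p : R * R => C p.1 p.2).
  have mq1 : measurable_fun setT (fun p : R * R => q p.1) by exact: (measurableT_comp mq).
  have mn2 : measurable_fun setT (fun p : R * R => `|p.2|%R) by exact: (measurableT_comp mn).
  apply: emeasurable_funM; last first.
    by apply: emeasurable_funM; [apply/measurable_EFinP|apply: mfi => //; exact: measurable_funM].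
  apply/measurable_EFinP.
  have -> : (fun p : R * R => (1 + p.1 ^+ 2)^-1)%R = (fun t : R => (1 + t ^+ 2)^-1)%R \o fst by [].
  apply: measurableT_comp => //; apply: continuous_measurable_fun.
  exact: continuous_oneDsqrV.
(* With [v = q y], one factor [1 / q] comes from the Jacobian and one from [|y| = |v| / q]; together
   they give the angular density [1 / (1 + t^2)]. *)
transitivity (\int[mu]_t \int[mu]_v C t v).
  apply: eq_integral => t _.
  rewrite -(@ge0_integral_affine _ (C t) (q t) 0%R)//; last 2 first.
  - by rewrite gt_eqF.
  - exact: (measurable_fun_pair2 t mC).
  rewrite -ge0_integralZl_EFin//; last first.
    have mCt : measurable_fun setT (C t) by exact: (measurable_fun_pair2 t mC).
    suff : measurable_fun [set: R] (C t \o (fun x => q t * x + 0)%R) by [].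
    apply: measurableT_comp => //.
    by apply: measurable_funD => //; exact: measurable_funM.
  apply: eq_integral => y _; rewrite /B /C addr0 normrM (gtr0_norm (q0 t)).
  rewrite (mulrC (q t) `|y|%R) (mulrAC _ (q t) t) ler_pM2r// !muleA -!EFinM; congr (_%:E * _ * _).
  by rewrite -q2; field; rewrite gt_eqF.
rewrite (@lebesgue_tonelli C)//.
apply: eq_integral => v _.
have [->|v0] := eqVneq v 0%R.
  by rewrite normr0 mul0e integral0_eq// => t _; rewrite /C normr0 mul0e mule0.
have vv : (0 < `|v|)%R by rewrite normr_gt0.
rewrite -integral_sector_angle.
rewrite muleA -ge0_integralZl//; last 3 first.
- apply/measurable_EFinP; apply: measurable_funM.
    by apply: continuous_measurable_fun; exact: continuous_oneDsqrV.
  apply/measurable_EFinP; apply: measurable_boolr_EFin; apply: measurable_fun_ler => //.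
  exact: measurable_funM.
- by move=> t _; rewrite lee_fin mulr_ge0// invr_ge0 addr_ge0// sqr_ge0.
- by rewrite mule_ge0.
apply: eq_integral => t _; rewrite /C EFinM [RHS]muleCA -muleA.
by rewrite mulrAC ler_pdivrMr// (mulrC t).
Qed.

(* Avoids the measurability of [acos], using the integral formula instead. *)
Lemma measurable_sector_angle : measurable_fun [set: R] (@sector_angle R).
Proof.
have -> : @sector_angle R = fine \o (fun k : R => \int[mu]_t
    ((1 + t ^+ 2)^-1 * (k * Num.sqrt (1 + t ^+ 2) <= t)%R%:R)%R%:E).
  by apply/funext => k /=; rewrite integral_sector_angle.
apply: measurableT_comp => //.
apply: (@measurable_lebesgue_integral (fun k t : R => 
    ((1 + t ^+ 2)^-1 * (k * Num.sqrt (1 + t ^+ 2) <= t)%R%:R)%R%:E)).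
  apply/measurable_EFinP; apply: measurable_funM.
    apply: (@measurableT_comp _ _ _ _ _ _ (fun t : R => (1 + t ^+ 2)^-1)%R) => //.
    by apply: continuous_measurable_fun; exact: continuous_oneDsqrV.
  apply/measurable_EFinP; apply: measurable_boolr_EFin; apply: measurable_fun_ler => //.
  apply: measurable_funM => //.
  apply: (measurableT_comp measurable_sqrtr); apply: measurable_funD => //.
  exact: measurable_funX.
by move=> k t; rewrite lee_fin mulr_ge0// invr_ge0 addr_ge0// sqr_ge0.
Qed.

End planar.

Section radial.
Local Open Scope ereal_scope.
Context (R : realType).
Notation mu := (@lebesgue_measure R).

Lemma integral_itvoy_ind (r : R) (g : R -> \bar R) :
  \int[mu]_(x in `]r, +oo[) g x = \int[mu]_x (g x * (r < x)%R%:R%:E).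
Proof.
rewrite integral_mkcond; apply: eq_integral => x _.
rewrite patchE mem_setE in_itv/= andbT.
by case: ifP; rewrite ?mule1 ?mule0.
Qed.

Lemma ge0_integral_even (g : R -> \bar R) :
  measurable_fun setT g -> (forall x, 0 <= g x) ->
  \int[mu]_x g `|x|%R = 2%:E * \int[mu]_x (g x * (0 < x)%R%:R%:E).
Proof.
move=> mg g0.
have mgn : measurable_fun [set: R] (fun x => g `|x|%R).
  by apply: (measurableT_comp mg); exact: normr_measurable.
rewrite -integral_itvoy_ind.
have -> : \int[mu]_x g `|x|%R = \int[mu]_(x in `]-oo, 0%R]) g `|x|%R + \int[mu]_(x in `]0%R, +oo[) g `|x|%R.
  rewrite -ge0_integral_setU//; last 2 first.
  - by apply: measurable_funTS.
  - apply/disj_set2P/seteqP; split => // x [] /=; rewrite !in_itv/= andbT => x0.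
    by rewrite ltNge x0.
  congr integral; apply/seteqP; split => // x _ /=; rewrite !in_itv/= andbT.
  by case: (leP x 0%R) => ?; [left|right].
have -> : \int[mu]_(x in `]-oo, 0%R]) g `|x|%R = \int[mu]_(x in `]0%R, +oo[) g x.
  rewrite integral_itv_obnd_cbnd; last exact: measurable_funTS.
  rewrite ge0_integration_by_substitution0//.
  by apply: eq_integral => x; rewrite inE/= in_itv/= => x0; rewrite ler0_norm.
have -> : \int[mu]_(x in `]0%R, +oo[) g `|x|%R = \int[mu]_(x in `]0%R, +oo[) g x.
  apply: eq_integral => x; rewrite inE/= in_itv/= andbT => x0.
  by rewrite gtr0_norm.
by rewrite -mule2n mule_natl.
Qed.

(** This is [r^2 = w^2 + h^2], [w dw = r dr], with the factor 2 due to evenness in [v]. Passing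
    through half squares makes it a translation by [h^2 / 2], so the square root need not be
    differentiated at 0. *)
Lemma ge0_integral_radial (H : R -> \bar R) (h : R) : (0 <= h)%R ->
  measurable_fun setT H -> (forall x, 0 <= H x) ->
  \int[mu]_v (`|v|%:E * H `|v|%R) =
  2%:E * \int[mu]_(r in `]h, +oo[) (r%:E * H (Num.sqrt (r ^+ 2 - h ^+ 2))%R).
Proof.
move=> h0 mH H0.
have ms : measurable_fun setT (fun u : R => Num.sqrt (2 * u))%R.
  by apply: (measurableT_comp (@measurable_sqrtr R)); exact: measurable_funM.
have mHs : measurable_fun setT (fun u : R => H (Num.sqrt (2 * u)))%R.
  exact: (measurableT_comp mH).
pose K (u : R) := H (Num.sqrt (2 * `|u|))%R.
have mK : measurable_fun setT K.
  by apply: (measurableT_comp mHs); exact: normr_measurable.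
transitivity (\int[mu]_x K x).
  rewrite -(@ge0_integral_half_square _ K)//; last by move=> y; exact: H0.
  apply: eq_integral => v _; congr (_ * H _).
  rewrite normrM normrM normr_id normfV (ger0_norm (ler0n _ 2)).
  rewrite [X in Num.sqrt X](_ : _ = `|v| ^+ 2)%R; last by field.
  by rewrite sqrtr_sqr normr_id.
rewrite (@ge0_integral_even (fun u => H (Num.sqrt (2 * u))%R))//.
congr (_ * _).
(* Here [u] stands for [r |r| / 2]; the indicator retains exactly [r > h]. *)
pose L (u : R) := H (Num.sqrt (2 * u - h ^+ 2))%R * (h ^+ 2 / 2 < u)%R%:R%:E.
have mL : measurable_fun setT L.
  apply: emeasurable_funM; last first.
    by apply: measurable_boolr_EFin; exact: measurable_fun_ltr.
  apply: (measurableT_comp mH); apply: (measurableT_comp (@measurable_sqrtr R)).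
  by apply: measurable_funB => //; exact: measurable_funM.
have L0 u : 0 <= L u by rewrite mule_ge0// lee_fin.
transitivity (\int[mu]_x L x).
  rewrite -(@ge0_integral_affine _ L 1%R (h ^+ 2 / 2)%R)// ?oner_eq0//.
  rewrite normr1 mul1e; apply: eq_integral => u _; rewrite /L mul1r ltrDr.
  by congr (H (Num.sqrt _) * _); field.
rewrite -(@ge0_integral_half_square _ L)// integral_itvoy_ind.
apply: eq_integral => r _; rewrite /L.
have [hr|rh] := ltP h r.
  have r0 : (0 < r)%R by exact: le_lt_trans hr.
  rewrite gtr0_norm// ltr_pM2r// -expr2 ltr_pXn2r ?nnegrE ?(ltW r0)// hr !mule1.
  by congr (_ * H (Num.sqrt _)); field.
suff -> : (h ^+ 2 / 2 < r * `|r| / 2)%R = false by rewrite !mule0.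
apply/negbTE; rewrite -leNgt ler_pM2r//.
have [r0|r0] := leP 0%R r.
  by rewrite ger0_norm// -expr2 ler_pXn2r ?nnegrE.
by rewrite ltr0_norm// (le_trans _ (sqr_ge0 h))// mulrN oppr_le0 -expr2 sqr_ge0.
Qed.

End radial.

Lemma sector_angle_ge0 (R : realType) (k : R) : 0 <= sector_angle k.
Proof.
rewrite -lee_fin -integral_sector_angle; apply: integral_ge0 => t _.
by rewrite lee_fin mulr_ge0// invr_ge0 addr_ge0// sqr_ge0.
Qed.

(** * The lens between the two disks, in terms of the distance to the UAV *)

Section disk.
Context (R : realType).
Notation mu := (@lebesgue_measure R).
Variables (h Rad Rmse : R) (cmu cmse : R * R).
Hypotheses (h0 : 0 < h) (Rad0 : 0 < Rad) (Rmse0 : 0 < Rmse).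
Hypothesis (cc : dist2 cmse cmu = Rad).

(** With [cmu] at the origin and [cmse] at [(Rad, 0)], a point at distance [w] from the origin lies
    in the second disk exactly when its first coordinate is at least [k w]. *)
Let k (w : R) := (Rad ^+ 2 + w ^+ 2 - Rmse ^+ 2) / (2 * Rad).

(** The cosine [k w / w] is at most -1 exactly when [w <= Rmse - Rad], and at least 1 exactly when
    [w <= Rad - Rmse] or [Rmse + Rad <= w]. Positivity of [w] keeps the quotient meaningful. *)
Lemma theta_sector_angle (w : R) : 0 < w ->
  theta Rad Rmse w = 2 * sector_angle (k w / w).
Proof.
move=> w0; rewrite /theta /sector_angle /k.
have D0 : 0 < 2 * Rad * w by rewrite !mulr_gt0.
have -> : (Rad ^+ 2 + w ^+ 2 - Rmse ^+ 2) / (2 * Rad) / w =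
   (Rad ^+ 2 + w ^+ 2 - Rmse ^+ 2) / (2 * Rad * w).
  by field; rewrite !gt_eqF.
have E1 : ((Rad ^+ 2 + w ^+ 2 - Rmse ^+ 2) / (2 * Rad * w) <= -1) = (w <= Rmse - Rad).
  rewrite ler_pdivrMr//; transitivity ((Rad + w) ^+ 2 <= Rmse ^+ 2).
    by apply/idP/idP => H; lra.
  by rewrite ler_pXn2r ?nnegrE ?addr_ge0 ?(ltW Rad0) ?(ltW w0) ?(ltW Rmse0)//; apply/idP/idP => H; lra.
have E2 : (1 <= (Rad ^+ 2 + w ^+ 2 - Rmse ^+ 2) / (2 * Rad * w)) =
    (w <= Rad - Rmse) || (Rmse + Rad <= w).
  rewrite ler_pdivlMr// mul1r; transitivity (Rmse ^+ 2 <= (Rad - w) ^+ 2).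
    by apply/idP/idP => H; lra.
  rewrite -(real_normK (num_real (Rad - w))) ler_pXn2r ?nnegrE ?(ltW Rmse0)//.
  by rewrite ler_normr; congr (_ || _); apply/idP/idP => H; lra.
have E3 : ((Rad ^+ 2 + w ^+ 2 - Rmse ^+ 2) / (2 * Rad * w) <= 1) = (`|Rad - w| <= Rmse).
  rewrite ler_pdivrMr// mul1r; transitivity ((Rad - w) ^+ 2 <= Rmse ^+ 2).
    by apply/idP/idP => H; lra.
  by rewrite -(real_normK (num_real (Rad - w))) ler_pXn2r ?nnegrE ?(ltW Rmse0).
rewrite (ltW w0)/= le_max leNgt w0/= E1.
case: ifP => [//|/negbT]; rewrite -ltNge => w1.
rewrite E2; case: ifP => [/andP[]|].
  rewrite ler_norml => /andP[w2 w3] w4; case: ifP => // /orP H.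
  (* The middle branch of [theta] is closed: at its end points [Rad - Rmse] and [Rmse + Rad] the
     cosine is 1 and [acos] already gives 0. *)
  rewrite (_ : _ / _ = 1) ?acos1 ?mulr0//.
  apply/eqP; rewrite eq_le E2; apply/andP; split; last by apply/orP.
  by rewrite E3 ler_norml; apply/andP; split; lra.
move/negbT; rewrite negb_and -!ltNge ltr_normr => H.
suff -> : (w <= Rad - Rmse) || (Rmse + Rad <= w) by rewrite mulr0.
by move: H => /orP[/orP[H|H]|H]; apply/orP; (try by left; lra); (try by right; lra); lra.
Qed.

Lemma sumr_sqr_ge0 (x y : R) : 0 <= x ^+ 2 + y ^+ 2.
Proof. by rewrite addr_ge0// sqr_ge0. Qed.

Lemma dist2_sqr (p q : R * R) : dist2 p q ^+ 2 = (p.1 - q.1) ^+ 2 + (p.2 - q.2) ^+ 2.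
Proof. by rewrite /dist2 sqr_sqrtr// sumr_sqr_ge0. Qed.

(* Agrees with [theta] at [w = sqrt (r^2 - h^2)] except possibly at [w = 0]. *)
Definition lens_angle (r : R) : R :=
  2 * sector_angle (k (Num.sqrt (r ^+ 2 - h ^+ 2)) * Num.sqrt (r ^+ 2 - h ^+ 2) `^ (-1)).

Let mk : measurable_fun setT k.
Proof.
apply: measurable_funM => //; apply: measurable_funB => //.
by apply: measurable_funD => //; exact: measurable_funX.
Qed.

Let msa : measurable_fun setT (fun w : R => sector_angle (k w * w `^ (-1))).
Proof.
apply: (measurableT_comp (@measurable_sector_angle R)).
by apply: measurable_funM => //; exact: measurable_powR.
Qed.

Let msq : measurable_fun setT (fun r : R => Num.sqrt (r ^+ 2 - h ^+ 2)).
Proof.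
apply: (measurableT_comp (@measurable_sqrtr R)).
by apply: measurable_funB => //; exact: measurable_funX.
Qed.

Lemma measurable_lens_angle : measurable_fun setT lens_angle.
Proof. by apply: measurable_funM => //; exact: (measurableT_comp msa). Qed.

Lemma lens_angle_ge0 r : 0 <= lens_angle r.
Proof. by rewrite mulr_ge0// sector_angle_ge0. Qed.

Lemma theta_lens_angle (r : R) : h < r ->
  theta Rad Rmse (Num.sqrt (r ^+ 2 - h ^+ 2)) = lens_angle r.
Proof.
move=> hr; have rh : (0 < r ^+ 2 - h ^+ 2)%R.
  by rewrite subr_sqr mulr_gt0// ?subr_gt0// addr_gt0// (lt_trans h0).
by rewrite theta_sector_angle ?sqrtr_gt0// /lens_angle powR_inv1 ?sqrtr_ge0.
Qed.

Let d := Num.sqrt (h ^+ 2 + Rad ^+ 2).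

Let itv_ind (r : R) : h < r -> (Num.sqrt (r ^+ 2 - h ^+ 2) <= Rad) = (r <= d).
Proof.
move=> hr; rewrite /d.
have r0 : 0 < r by exact: lt_trans hr.
have rh : 0 <= r ^+ 2 - h ^+ 2.
  by rewrite subr_sqr mulr_ge0 ?subr_ge0 ?addr_ge0 ?(ltW hr) ?(ltW r0) ?(ltW h0).
rewrite -(ler_pXn2r (ltn0Sn 1)) ?nnegrE ?sqrtr_ge0 ?(ltW Rad0) ?(ltW r0)//.
rewrite sqr_sqrtr// -[in RHS](ler_pXn2r (ltn0Sn 1)) ?nnegrE ?sqrtr_ge0 ?(ltW Rad0) ?(ltW r0)//.
by rewrite sqr_sqrtr ?addr_ge0 ?sqr_ge0// lerBlDl.
Qed.

Lemma measurable_dist2 (c : R * R) : measurable_fun setT (fun p : R * R => dist2 p c).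
Proof.
apply: (measurableT_comp (@measurable_sqrtr R)).
by apply: measurable_funD; apply: measurable_funX; exact: measurable_funB.
Qed.

Lemma measurable_in_disk c r : measurable_fun setT (fun p : R * R => in_disk c r p).
Proof. by apply: measurable_fun_ler => //; exact: measurable_dist2. Qed.

Lemma measurable_uav_dist c : measurable_fun setT (fun p : R * R => uav_dist h c p).
Proof.
apply: (measurableT_comp (@measurable_sqrtr R)); apply: measurable_funD => //.
by apply: measurable_funX; exact: measurable_dist2.
Qed.

Local Open Scope ereal_scope.

(** A rigid motion puts [cmu] at the origin and [cmse] on the positive first axis. The disk [cmu]
    then constrains the radius only, and the other disk is a threshold on the first coordinate, the
    form handled by [ge0_integral_polar]. *)
Lemma ge0_integral_lens (F : R -> \bar R) :
  measurable_fun setT F -> (forall x, 0 <= F x) ->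
  \int[mu]_x1 \int[mu]_x2 (F (uav_dist h cmu (x1, x2)) *
    (in_disk cmse Rmse (x1, x2) && in_disk cmu Rad (x1, x2))%:R%:E) =
  \int[mu]_(r in `]h, d]) (F r * (r * lens_angle r)%R%:E).
Proof.
move=> mF F0.
pose G (p : R * R) := F (uav_dist h cmu p) *
    (in_disk cmse Rmse p && in_disk cmu Rad p)%:R%:E.
have mG : measurable_fun setT G.
  apply: emeasurable_funM.
    by apply: (measurableT_comp mF); exact: measurable_uav_dist.
  by apply: measurable_boolr_EFin; apply: measurable_and; exact: measurable_in_disk.
have G0 p : 0 <= G p by rewrite mule_ge0// lee_fin.
(* The direction from [cmu] to [cmse]; it is a unit vector because [cmse] lies on the boundary
   circle. *)
pose e1 := ((cmse.1 - cmu.1) / Rad)%R; pose e2 := ((cmse.2 - cmu.2) / Rad)%R.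
have ee : (e1 ^+ 2 + e2 ^+ 2 = 1)%R.
  rewrite /e1 /e2 !expr_div_n -mulrDl -dist2_sqr cc divff//.
  by rewrite expf_neq0// gt_eqF.
have c1E : (cmse.1 = e1 * Rad + cmu.1)%R by rewrite /e1; field; rewrite gt_eqF.
have c2E : (cmse.2 = e2 * Rad + cmu.2)%R by rewrite /e2; field; rewrite gt_eqF.
rewrite -(@ge0_integral_rotation _ G cmu.1 cmu.2 e1 e2)//.
pose f (w : R) := F (Num.sqrt (w ^+ 2 + h ^+ 2))%R * (w <= Rad)%R%:R%:E.
have mf : measurable_fun setT f.
  apply: emeasurable_funM; last first.
    by apply: measurable_boolr_EFin; exact: measurable_fun_ler.
  apply: (measurableT_comp mF); apply: (measurableT_comp (@measurable_sqrtr R)).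
  by apply: measurable_funD => //; exact: measurable_funX.
have f0 w : 0 <= f w by rewrite mule_ge0// lee_fin.
transitivity (\int[mu]_x \int[mu]_y (f (Num.sqrt (x ^+ 2 + y ^+ 2))%R *
     (k (Num.sqrt (x ^+ 2 + y ^+ 2)) <= x)%R%:R%:E)).
  apply: eq_integral => u _; apply: eq_integral => v _.
  set p := (_, _); set w := Num.sqrt (u ^+ 2 + v ^+ 2).
  have w2 : (w ^+ 2 = u ^+ 2 + v ^+ 2)%R by rewrite sqr_sqrtr// sumr_sqr_ge0.
  have pw : dist2 p cmu = w.
    rewrite /dist2 /w; congr Num.sqrt; rewrite /p /=.
    by transitivity ((e1 ^+ 2 + e2 ^+ 2) * (u ^+ 2 + v ^+ 2))%R; [ring|rewrite ee mul1r].
  have -> : (k w <= u)%R = in_disk cmse Rmse p.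
    rewrite /k /in_disk ler_pdivrMr ?mulr_gt0//.
    rewrite -[in RHS](ler_pXn2r (ltn0Sn 1)) ?nnegrE ?sqrtr_ge0 ?(ltW Rmse0)//.
    rewrite dist2_sqr c1E c2E /p/= w2.
    have -> : ((e1 * u - e2 * v + cmu.1 - (e1 * Rad + cmu.1)) ^+ 2 +
      (e2 * u + e1 * v + cmu.2 - (e2 * Rad + cmu.2)) ^+ 2 =
      (e1 ^+ 2 + e2 ^+ 2) * ((u - Rad) ^+ 2 + v ^+ 2))%R by ring.
    by rewrite ee mul1r; apply/idP/idP => H; nra.
  rewrite /G /f /uav_dist /in_disk pw -/(in_disk _ _ _).
  by rewrite -muleA -EFinM -natrM mulnb andbC.
rewrite ge0_integral_polar//.
pose H (w : R) := f w * (sector_angle (k w * w `^ (-1))%R)%:E.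
have mH : measurable_fun setT H by apply: emeasurable_funM => //; apply/measurable_EFinP.
have H0 w : 0 <= H w by rewrite mule_ge0// lee_fin sector_angle_ge0.
transitivity (\int[mu]_v (`|v|%:E * H `|v|%R)).
  by apply: eq_integral => v _; rewrite /H powR_inv1.
rewrite (@ge0_integral_radial _ H h)// ?ltW//.
have EH (r : R) : (h < r)%R -> (r <= d)%R ->
   2%:E * (r%:E * H (Num.sqrt (r ^+ 2 - h ^+ 2))%R) = F r * (r * lens_angle r)%R%:E.
  move=> hr rd; have rh : (0 < r ^+ 2 - h ^+ 2)%R.
    by rewrite subr_sqr mulr_gt0// ?subr_gt0// addr_gt0// (lt_trans h0).
  rewrite /H /f itv_ind// rd mule1.
  rewrite sqr_sqrtr ?ltW// subrK sqrtr_sqr gtr0_norm ?(lt_trans h0)//.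
  by rewrite muleA -EFinM muleCA -EFinM; congr (_ * _%:E); rewrite /lens_angle; ring.
have mHs : measurable_fun [set: R] (fun r : R => r%:E * H (Num.sqrt (r ^+ 2 - h ^+ 2))%R).
  apply: emeasurable_funM; first exact/measurable_EFinP.
  apply: (measurableT_comp mH); apply: (measurableT_comp (@measurable_sqrtr R)).
  by apply: measurable_funB => //; exact: measurable_funX.
rewrite -ge0_integralZl//; last 2 first.
- by apply: measurable_funTS; exact: mHs.
- move=> r; rewrite /= in_itv/= andbT => hr; rewrite mule_ge0// lee_fin ltW//.
  exact: lt_trans hr.
rewrite integral_mkcond [RHS]integral_mkcond; apply: eq_integral => r _.
rewrite !patchE !mem_setE !in_itv/= andbT; case: ifPn => [hr|]; last first.
  by [].
rewrite /=; case: ifPn => [rd|rd]; first exact: EH.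
by rewrite /H /f itv_ind// (negbTE rd) mule0 mul0e mule0 mule0.
Qed.

End disk.

(** * Erlang tails *)

Section gamma.
Context (R : realType).
Notation mu := (@lebesgue_measure R).
Implicit Types (x t u c : R) (m k : nat).

(** [(c x)^k / k!] is a single term of the exponential series of [c x]. The bound serves both the
    decay of Erlang tails and the domination of Laplace integrands. *)
Lemma exprn_expR_le k c x : 0 < c -> 0 <= x ->
  x ^+ k * expR (- (c * x)) <= k`!%:R / c ^+ k.
Proof.
move=> c0 x0; rewrite expRN.
have ek : (c * x) ^+ k / k`!%:R <= expR (c * x).
  case: k => [|k].
    apply: le_trans (expR_ge1Dx _).
    by rewrite expr0 fact0 divr1 lerDl mulr_ge0// ltW.
  apply: le_trans (expR_ge1Dxn k _); last by rewrite mulr_ge0// ltW.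
  by rewrite lerDr.
rewrite ler_pdivrMr ?expR_gt0// mulrAC ler_pdivlMr ?exprn_gt0//.
by move: ek; rewrite ler_pdivrMr ?ltr0n ?fact_gt0// exprMn mulrC (mulrC (expR _)).
Qed.

(** The probability that a Poisson variable of mean [u t] is below [m]; for [m > 0], equally that a
    Gamma variable of shape [m] and rate [u] is at least [t]. *)
Definition erlang_tail m u t : R := \sum_(k < m) ((u * t) ^+ k / k`!%:R * expR (- (u * t))).

(** The derivatives of the summands telescope and only the last one leaves a term, minus the Erlang
    density. *)
Lemma is_derive_erlang_tail m u t :
  is_derive t 1 (erlang_tail m.+1 u)
    (- (u ^+ m.+1 * t ^+ m / m`!%:R * expR (- (u * t)))).
Proof.
have de : is_derive t 1 (fun t => expR (- (u * t))) (- u * expR (- (u * t))).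
  by apply: is_derive_eq; rewrite /GRing.scale/= ; ring.
elim: m => [|m IH].
  have -> : erlang_tail 1 u = fun t => expR (- (u * t)).
    by apply/funext => y; rewrite /erlang_tail big_ord1 expr0 fact0 divr1 mul1r.
  by apply: is_derive_eq; rewrite expr1 expr0 fact0; field.
have -> : erlang_tail m.+2 u = erlang_tail m.+1 u \+
    (fun t => (u * t) ^+ m.+1 * ((m.+1)`!%:R)^-1 * expR (- (u * t))).
  by apply/funext => y; rewrite /erlang_tail big_ord_recr.
have dp : is_derive t 1 (fun t => (u * t) ^+ m.+1) (u * m.+1%:R * (u * t) ^+ m).
  have du : is_derive t 1 (fun t : R => u * t) u.
    by apply: is_derive_eq; rewrite /GRing.scale/=; ring.
  have := @is_deriveX R R (fun t => u * t) m.+1 t 1 u du.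
  have -> : (fun t => u * t) ^+ m.+1 = (fun t => (u * t) ^+ m.+1).
    apply/funext => y; elim: (m.+1) => [|n IHn]; first by rewrite !expr0.
    by rewrite !exprS -IHn.
  by move/is_derive_eq; apply; rewrite /GRing.scale/=; ring.
apply: is_derive_eq; rewrite /GRing.scale/=.
rewrite factS natrM !exprMn !exprS; field.
by rewrite pnatr_eq0 -lt0n fact_gt0/= gt_eqF// ltr_pwDl.
Qed.

Lemma cvg_erlang_tail m u : 0 < u -> erlang_tail m u x @[x --> +oo] --> (0 : R).
Proof.
move=> u0; elim: m => [|k IH].
  by rewrite /erlang_tail; under eq_fun do rewrite big_ord0; exact: cvg_cst.
have -> : erlang_tail k.+1 u = erlang_tail k u \+
    (fun t => (u * t) ^+ k * (k`!%:R)^-1 * expR (- (u * t))).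
  by apply/funext => y; rewrite /erlang_tail big_ord_recr.
rewrite -[X in _ --> X](addr0 0); apply: cvgD => //.
(* The exponential is split into two halves of rate [u / 2]: one absorbs the power, at the price of
   [k! / (u / 2)^k], and the other tends to 0. *)
pose c := u ^+ k / k`!%:R * (k`!%:R / (u / 2) ^+ k).
apply: (@squeeze_cvgr _ _ _ _ (cst 0) (fun x => c * expR (- (u / 2 * x)))).
- near=> x; have x0 : 0 <= x by near: x; exact: nbhs_pinfty_ge.
  rewrite mulr_ge0 ?expR_ge0 ?divr_ge0 ?exprn_ge0 ?mulr_ge0 ?(ltW u0)//=.
  have -> : expR (- (u * x)) = expR (- (u / 2 * x)) * expR (- (u / 2 * x)).
    by rewrite -expRD; congr expR; field.
  have := @exprn_expR_le k (u / 2) x (divr_gt0 u0 (ltr0n _ 2)) x0.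
  set E := expR _; set D := _ / _ => hE.
  rewrite /c exprMn mulrA ler_wpM2r ?expR_ge0//.
  have -> : u ^+ k * x ^+ k / k`!%:R * E = u ^+ k / k`!%:R * (x ^+ k * E) by ring.
  by rewrite ler_wpM2l// divr_ge0// exprn_ge0// ltW.
- exact: cvg_cst.
- rewrite -[X in _ --> X](mulr0 c); apply: cvgM; first exact: cvg_cst.
  apply: (@cvg_comp _ _ _ (fun x => u / 2 * x) (fun z => expR (- z)) _ (pinfty_nbhs R)); last exact: cvgr_expR.
  by apply: gt0_cvgMry; rewrite ?divr_gt0.
Unshelve. all: end_near. Qed.

Lemma continuous_erlang_pdf (v u : R) m :
  continuous (fun g : R => v ^+ m.+1 * g ^+ m / m`!%:R * expR (- (u * g))).
Proof.
move=> x; apply: cvgM.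
  apply: cvgM; last exact: cvg_cst.
  by apply: cvgM; [exact: cvg_cst|exact: exprn_continuous].
apply: (@continuous_comp _ _ _ (fun g => - (u * g)) expR); last exact: continuous_expR.
by apply: cvgN; apply: cvgM; [exact: cvg_cst|exact: cvg_id].
Qed.

Lemma integral_erlang_tail m u t : 0 < u -> 0 <= t ->
  (\int[mu]_(g in `[t, +oo[) (u ^+ m.+1 * g ^+ m / m`!%:R * expR (- (u * g)))%R%:E =
   (erlang_tail m.+1 u t)%:E)%E.
Proof.
move=> u0 t0.
have cF x : {for x, continuous (- erlang_tail m.+1 u)}.
  apply: differentiable_continuous; apply/derivable1_diffP.
  by apply: derivableN; have [] := is_derive_erlang_tail m u x.
rewrite (@ge0_continuous_FTC2y _ _ (- erlang_tail m.+1 u) _ 0).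
- by rewrite sub0e -EFinN opprK.
- move=> x tx; have x0 := le_trans t0 tx.
  by rewrite mulr_ge0 ?expR_ge0// mulr_ge0 ?invr_ge0// mulr_ge0// exprn_ge0// ltW.
- by apply: continuous_subspaceT; exact: continuous_erlang_pdf.
- by rewrite -oppr0; apply: cvgN; exact: cvg_erlang_tail.
- by move=> x _; apply: derivableN; have [] := is_derive_erlang_tail m u x.
- by apply: cvg_at_right_filter; exact: cF.
- move=> x _; have [d1 d2] := is_derive_erlang_tail m u x.
  by rewrite derive1E deriveN// d2 opprK.
Qed.

Lemma gamma_pdf_ge0 m x : 0 <= gamma_pdf m x.
Proof.
rewrite /gamma_pdf; case: ifP => // x0.
by rewrite mulr_ge0 ?expR_ge0// mulr_ge0 ?invr_ge0// mulr_ge0// exprn_ge0// ltW.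
Qed.

Lemma measurable_gamma_pdf m : measurable_fun [set: R] (@gamma_pdf R m).
Proof.
apply: measurable_fun_ifT => //; first exact: measurable_fun_ltr.
apply: measurable_funM.
  by apply: measurable_funM => //; apply: measurable_funM => //; exact: exprn_measurable.
apply: (measurableT_comp (@measurable_expR R)); exact: measurableT_comp.
Qed.

Lemma integral_gamma_pdf_tail m t : (0 < m)%N -> 0 < t ->
  (\int[mu]_g ((gamma_pdf m g)%:E * (t <= g)%R%:R%:E) = (erlang_tail m m%:R t)%:E)%E.
Proof.
case: m => // m _ t0.
rewrite -integral_erlang_tail ?ltr0n ?ltW// [RHS]integral_mkcond.
apply: eq_integral => g _; rewrite patchE mem_setE in_itv/= andbT.
case: ifPn => [tg|]; last by rewrite mule0.
by rewrite mule1 /gamma_pdf (lt_le_trans t0 tg).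
Qed.

(** Exponential tilting: multiplying the density of rate [M] by [e^(- c g)] gives, up to the stated
    constant, the Gamma density of rate [M + c], whose mass is the Erlang tail at 0, namely 1. *)
Lemma integral_gamma_pdf_expR m c : (0 < m)%N -> 0 <= c ->
  (\int[mu]_g ((gamma_pdf m g)%:E * (expR (- (c * g)))%:E) =
   (((1 + c / m%:R) ^+ m)^-1)%:E)%E.
Proof.
case: m => // m _ c0.
pose M : R := m.+1%:R; have M0 : 0 < M by rewrite ltr0n.
pose u := M + c; have u0 : 0 < u by rewrite ltr_wpDr.
transitivity ((((1 + c / M) ^+ m.+1)^-1)%:E * \int[mu]_(g in `[0%R, +oo[)
    (u ^+ m.+1 * g ^+ m / m`!%:R * expR (- (u * g)))%R%:E)%E; last first.
  rewrite integral_erlang_tail// /erlang_tail big_ord_recl big1/=.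
    by rewrite mulr0 oppr0 expR0 expr0 fact0 divr1 mulr1 addr0 mule1.
  by move=> i _; rewrite mulr0 exprS !mul0r.
have mE (v : R) : measurable_fun setT (fun g : R => (v ^+ m.+1 * g ^+ m / m`!%:R * expR (- (u * g)))%R%:E).
  apply/measurable_EFinP; apply: continuous_measurable_fun.
  exact: continuous_erlang_pdf.
rewrite -integral_itv_obnd_cbnd; last by apply: measurable_funTS; exact: mE.
rewrite -ge0_integralZl//; last 3 first.
- by apply: measurable_funTS; exact: mE.
- move=> x; rewrite /= in_itv/= andbT => x0.
  by rewrite lee_fin mulr_ge0 ?expR_ge0// mulr_ge0 ?invr_ge0// mulr_ge0// exprn_ge0// ltW.
- by rewrite lee_fin invr_ge0 exprn_ge0// addr_ge0// divr_ge0// ltW.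
rewrite [RHS]integral_mkcond.
apply: eq_integral => g _; rewrite patchE mem_setE in_itv/= andbT.
rewrite -/M /gamma_pdf; case: ifPn => [g0|]; last by rewrite mul0e.
rewrite -!EFinM; congr EFin; rewrite -/M /=.
have -> : expR (- (u * g)) = expR (- (M * g)) * expR (- (c * g)).
  by rewrite -expRD; congr expR; rewrite /u; ring.
have -> : u ^+ m.+1 = (1 + c / M) ^+ m.+1 * M ^+ m.+1.
  by rewrite -exprMn; congr (_ ^+ _); rewrite /u; field; rewrite gt_eqF.
have : (1 + c / M) ^+ m.+1 != 0.
  by rewrite expf_neq0// gt_eqF// ltr_wpDr// divr_ge0// ltW.
have mf0 : m`!%:R != 0 :> R by rewrite pnatr_eq0 -lt0n fact_gt0.
by set A := (1 + c / M) ^+ m.+1 => A0; rewrite !mulrA mulVf// mul1r.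
Qed.

End gamma.

(** * Shot noise of a marked Poisson process *)

Section finite_measure_of.
Context d (T : measurableType d) (R : realType).
Variables (nu : {measure set T -> \bar R}) (nufin : fin_num_fun nu).

Let nu_alias : set T -> \bar R := nu.
HB.instance Definition _ := Measure.on nu_alias.
HB.instance Definition _ := Measure_isFinite.Build _ _ _ nu_alias nufin.
Definition finite_measure_of : {finite_measure set T -> \bar R} := nu_alias.

End finite_measure_of.

Section product.
Local Open Scope ereal_scope.
Context d1 d2 (T1 : measurableType d1) (T2 : measurableType d2) (R : realType).
Variables (m1 : {sigma_finite_measure set T1 -> \bar R})
          (m2 : {sigma_finite_measure set T2 -> \bar R}).
Lemma product_measure_sigma_finite : sigma_finite setT (m1 \x m2).
Proof.
have [F F1 F2] := sigma_finiteT m1; have [G G1 G2] := sigma_finiteT m2.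
(* Rectangles of the two covers, enumerated by the code of the index pair; an integer that codes no
   pair repeats the rectangle [(0, 0)]. *)
exists (fun n => let ij := odflt (0, 0)%N (unpickle n) in F ij.1 `*` G ij.2).
  apply/esym; rewrite -subTset => -[x y] _.
  have : setT x by []; have : setT y by []; rewrite F1 G1 => -[j _ Gy] [i _ Fx].
  by exists (pickle (i, j)) => //; rewrite pickleK.
move=> n; case: (odflt _ _) => i j /=.
have [mF Foo] := F2 i; have [mG Goo] := G2 j; split; first exact: measurableX.
by rewrite product_measure1E// lte_mul_pinfty// ge0_fin_numE.
Qed.

Definition prod_measure : {sigma_finite_measure set (T1 * T2)%type -> \bar R} :=
  HB.pack (m1 \x m2) (Measure_isSigmaFinite.Build _ _ _ (m1 \x m2) product_measure_sigma_finite).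

End product.

Section ppp.
Local Open Scope ereal_scope.
Context (R : realType).
Notation mu := (@lebesgue_measure R).
Notation nodeT := ((measurableTypeR R * measurableTypeR R) * measurableTypeR R)%type.

Definition mu3 : {sigma_finite_measure set nodeT -> \bar R} :=
  prod_measure (prod_measure mu mu) mu.

Lemma node_tonelli (phi : (R * R) * R -> \bar R) :
  measurable_fun setT phi -> (forall p, 0 <= phi p) ->
  \int[mu]_x1 \int[mu]_x2 \int[mu]_g phi ((x1, x2), g) = \int[mu3]_p phi p.
Proof.
move=> mphi phi0.
have E1 := @fubini_tonelli1 _ _ (measurableTypeR R * measurableTypeR R)%type
  (measurableTypeR R) R (prod_measure mu mu) mu phi mphi phi0.
rewrite /mu3 [RHS]E1.
have mF : measurable_fun [set: measurableTypeR R * measurableTypeR R] (fubini_F mu phi).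
  exact: (@measurable_fun_fubini_tonelli_F _ _ (measurableTypeR R * measurableTypeR R)%type
    (measurableTypeR R) R mu phi mphi phi0).
have F0 x : 0 <= fubini_F mu phi x by apply: integral_ge0.
by rewrite [RHS](@fubini_tonelli1 _ _ (measurableTypeR R) (measurableTypeR R) R mu mu _ mF F0).
Qed.

Variables (w pow : (R * R) * R -> R).
Hypotheses (mw : measurable_fun setT w) (w0 : forall p, (0 <= w p)%R).
Hypothesis mpow : measurable_fun setT pow.
Hypothesis wfin : \int[mu3]_p (w p)%:E < +oo.

(** Convolution with the power of one more node: the image of [w . (mu3 x rho)] under
    [(p, z) |-> pow p + z]. Its mass is the product of the two masses, so finiteness survives
    iteration. *)
Lemma shot_step (rho : {finite_measure set (measurableTypeR R) -> \bar R}) :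
  exists rho' : {finite_measure set (measurableTypeR R) -> \bar R},
  forall H : R -> \bar R, measurable_fun setT H -> (forall y, 0 <= H y) ->
    \int[rho']_z H z = \int[mu3]_p ((w p)%:E * \int[rho]_z H (pow p + z)%R).
Proof.
have mw1 : measurable_fun [set: nodeT * measurableTypeR R] (w \o fst).
  exact: measurableT_comp.
have mphi : measurable_fun [set: nodeT * measurableTypeR R]
    (fun q : nodeT * measurableTypeR R => (pow q.1 + q.2)%R : measurableTypeR R).
  apply: (@measurable_funD _ (nodeT * measurableTypeR R)%type R) => //.
  exact: (measurableT_comp mpow).
have [nu _ nuE] := @weighted_pushforward_exists _ _
  (nodeT * measurableTypeR R)%type (measurableTypeR R) R (prod_measure mu3 rho)
  (w \o fst) (fun q => pow q.1 + q.2)%R (fun q => w0 q.1) mw1 mphi.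
have nuH (H : R -> \bar R) : measurable_fun setT H -> (forall y, 0 <= H y) ->
    \int[nu]_z H z = \int[mu3]_p ((w p)%:E * \int[rho]_z H (pow p + z)%R).
  move=> mH H0; rewrite nuE//.
  rewrite [LHS]fubini_tonelli1/=; last 2 first.
  - apply: emeasurable_funM; first exact/measurable_EFinP.
    by apply: (measurableT_comp mH); exact: mphi.
  - by move=> q; rewrite mule_ge0// lee_fin.
  apply: eq_integral => p _; rewrite /fubini_F/= ge0_integralZl//.
  - apply: (measurableT_comp mH).
    exact: measurable_funD.
  - by rewrite lee_fin.
have fin : fin_num_fun nu.
  apply: lty_fin_num_fun.
  rewrite -[X in X < _]mul1e -integral_cst// nuH//.
  under eq_integral do rewrite integral_cst// mul1e.
  rewrite ge0_integralZr//; last by move=> p _; rewrite lee_fin.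
  - apply: lte_mul_pinfty => //.
    + by apply: integral_ge0 => p _; rewrite lee_fin.
    + by rewrite ge0_fin_numE ?integral_ge0// => p _; rewrite lee_fin.
    + have := fin_num_measure rho _ (@measurableT _ (measurableTypeR R)).
      by rewrite ge0_fin_numE.
  - exact/measurable_EFinP.
by exists (finite_measure_of fin).
Qed.

Lemma shot_measures_exist :
  exists rho : nat -> {finite_measure set (measurableTypeR R) -> \bar R},
  (forall H : R -> \bar R, measurable_fun setT H -> \int[rho 0%N]_z H z = H 0%R) /\
  (forall N (H : R -> \bar R), measurable_fun setT H -> (forall y, 0 <= H y) ->
    \int[rho N.+1]_z H z = \int[mu3]_p ((w p)%:E * \int[rho N]_z H (pow p + z)%R)).
Proof.
pose step rho := sval (cid (shot_step rho)).
pose d0 : {finite_measure set (measurableTypeR R) -> \bar R} :=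
  @dirac _ (measurableTypeR R) 0%R R.
exists (fun N => iter N step d0); split.
  by move=> H mH /=; rewrite integral_dirac// diracT mul1e.
move=> N H mH H0 /=; rewrite /step; case: cid => rho' /= ->//.
Qed.

Variable rho : nat -> {finite_measure set (measurableTypeR R) -> \bar R}.
Hypothesis rho_0 :
  forall H : R -> \bar R, measurable_fun setT H -> \int[rho 0%N]_z H z = H 0%R.
Hypothesis rho_S :
  forall N (H : R -> \bar R), measurable_fun setT H -> (forall y, 0 <= H y) ->
    \int[rho N.+1]_z H z = \int[mu3]_p ((w p)%:E * \int[rho N]_z H (pow p + z)%R).

Variable Phi : (R * R) * R -> R -> \bar R.
Hypothesis mPhi : measurable_fun setT (fun q : ((R * R) * R) * R => Phi q.1 q.2).
Hypothesis Phi0 : forall p y, 0 <= Phi p y.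

(** [Phi p y] is the score of node [p] against interference [y]. The offset [y] holds the power of
    nodes already removed from the list, so that the sum obeys a recursion on the list. *)
Definition leave_one_out_sum (s : seq (@node R)) (y : R) : \bar R :=
  \sum_(n < size s) Phi (nth node0 s n)
    (y + \sum_(j < size s | (j : nat) != n) pow (nth node0 s j))%R.

Lemma leave_one_out_sum_cons p s y :
  leave_one_out_sum (p :: s) y =
  Phi p (y + \sum_(q <- s) pow q)%R + leave_one_out_sum s (y + pow p)%R.
Proof.
rewrite /leave_one_out_sum /= big_ord_recl/=; congr (_ + _).
  congr (Phi p (y + _)%R).
  by rewrite big_mkcond big_ord_recl/= add0r (big_nth node0) big_mkord.
apply: eq_bigr => i _; congr (Phi _ _); rewrite -addrA; congr (y + _)%R.
by rewrite big_mkcond big_ord_recl/=; congr (_ + _)%R; rewrite [RHS]big_mkcond.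
Qed.

Let Psi (y : R) := \int[mu3]_p ((w p)%:E * Phi p y).

Lemma measurable_shot_integral (m : {finite_measure set (measurableTypeR R) -> \bar R})
    d (T : measurableType d) (a : T -> R) (H : R -> \bar R) :
  measurable_fun setT H -> (forall y, 0 <= H y) -> measurable_fun setT a ->
  measurable_fun setT (fun x : T => \int[m]_z H (a x + z)%R).
Proof.
move=> mH H0 ma.
apply: (@measurable_fun_fubini_tonelli_F _ _ T (measurableTypeR R) R m
  (fun q => H (a q.1 + q.2)%R)) => //.
apply: (measurableT_comp mH); apply: (@measurable_funD _ (T * measurableTypeR R)%type R) => //.
exact: (measurableT_comp ma).
Qed.

Lemma measurable_mean : measurable_fun [set: R] Psi.
Proof.
apply: (@measurable_fun_fubini_tonelli_G _ _ nodeT (measurableTypeR R) R mu3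
  (fun q => (w q.1)%:E * Phi q.1 q.2)).
  by apply: emeasurable_funM => //; apply/measurable_EFinP; exact: (measurableT_comp mw).
by move=> q; rewrite mule_ge0// lee_fin.
Qed.

Let Psi0 y : 0 <= Psi y.
Proof. by apply: integral_ge0 => p _; rewrite mule_ge0// lee_fin. Qed.

Let mPhip p : measurable_fun [set: R] (Phi p).
Proof. exact: (measurable_fun_pair2 p mPhi). Qed.

Let mshift d (T : measurableType d) (a : T -> R) (H : R -> \bar R) :
  measurable_fun setT H -> measurable_fun setT a -> measurable_fun setT (fun z => H (a z)).
Proof. by move=> mH ma; exact: (measurableT_comp mH). Qed.

Let mshiftD (a : R) (H : R -> \bar R) :
  measurable_fun setT H -> measurable_fun [set: R] (fun z : R => H (a + z)%R).
Proof. by move=> mH; apply: (measurableT_comp mH); exact: measurable_funD. Qed.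

(* The extra summand [H] keeps the induction closed: it absorbs the term of the node
   that is integrated out first. *)
Lemma iterint_leave_one_out N (c y : R) (H : R -> \bar R) : (0 <= c)%R ->
  measurable_fun setT H -> (forall y, 0 <= H y) ->
  iterint N (fun s => (c * \prod_(p <- s) w p)%R%:E *
    (H (y + \sum_(p <- s) pow p)%R + leave_one_out_sum s y)) =
  c%:E * (\int[rho N]_z H (y + z)%R + N%:R%:E * \int[rho N.-1]_z Psi (y + z)%R).
Proof.
have mDl a : measurable_fun [set: R] (fun z : R => a + z)%R by exact: measurable_funD.
elim: N c y H => [|N IH] c y H c0 mH H0.
  rewrite /= !big_nil mulr1 mul0e adde0 /leave_one_out_sum big_ord0 adde0.
  by rewrite rho_0; last exact: mshiftD.
rewrite [LHS]/=.
pose h p := (c * w p)%R%:E * ((\int[rho N]_z H (y + pow p + z)%R +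
   \int[rho N]_z Phi p (y + z)%R) + N%:R%:E * \int[rho N.-1]_z Psi (y + pow p + z)%R).
have E (p : (R * R) * R) : iterint N (fun s => (c * \prod_(p0 <- p :: s) w p0)%R%:E *
    (H (y + \sum_(p0 <- p :: s) pow p0)%R + leave_one_out_sum (p :: s) y)) = h p.
  (* The score of the head [p] depends on the total power minus its own; written in terms of the
     total [x], it becomes part of the extra summand for the remaining nodes. *)
  pose H' x := H x + Phi p (x - pow p)%R.
  have mB : measurable_fun [set: R] (fun x : R => x - pow p)%R by exact: measurable_funB.
  have mH' : measurable_fun setT H' by apply: emeasurable_funD => //; exact: mshift.
  have H'0 x : 0 <= H' x by rewrite adde_ge0.
  have := IH (c * w p)%R (y + pow p)%R H' (mulr_ge0 c0 (w0 p)) mH' H'0.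
  have -> : \int[rho N]_z H' (y + pow p + z)%R =
      \int[rho N]_z H (y + pow p + z)%R + \int[rho N]_z Phi p (y + z)%R.
    rewrite -ge0_integralD//; last 2 first.
    - exact: mshiftD.
    - by apply: mshiftD; exact: mPhip.
    apply: eq_integral => z _; congr (_ + Phi p _); ring.
  move=> IHp; rewrite /h -IHp; congr (iterint N _); apply/funext => s.
  rewrite leave_one_out_sum_cons !big_cons mulrA; congr (_ * _).
  rewrite /H' -[RHS]addeA (addrA y (pow p)); congr (_ + (Phi p _ + _)); ring.
under eq_integral do under eq_integral do under eq_integral do rewrite E.
have mi1 : measurable_fun [set: nodeT] (fun p => \int[rho N]_z H (y + pow p + z)%R).
  apply: measurable_shot_integral => //; apply: measurable_funD => //.
have mi2 : measurable_fun [set: nodeT] (fun p => \int[rho N]_z Phi p (y + z)%R).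
  apply: (@measurable_fun_fubini_tonelli_F _ _ nodeT (measurableTypeR R) R (rho N)
    (fun q => Phi q.1 (y + q.2)%R)) => //.
  apply: (@measurableT_comp _ _ _ _ _ _ (fun q : ((R * R) * R) * R => Phi q.1 q.2) _ (fun q : ((R * R) * R) * R => (q.1, y + q.2)%R)) => //.
  by apply: measurable_fun_pair => //; exact: measurable_funD.
have mi3 : measurable_fun [set: nodeT] (fun p => \int[rho N.-1]_z Psi (y + pow p + z)%R).
  apply: measurable_shot_integral => //; first exact: measurable_mean.
  by apply: measurable_funD => //.
have mwE : measurable_fun [set: nodeT] (fun p => (w p)%:E) by exact/measurable_EFinP.
have i1 p : 0 <= \int[rho N]_z H (y + pow p + z)%R by exact: integral_ge0.
have i2 p : 0 <= \int[rho N]_z Phi p (y + z)%R by exact: integral_ge0.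
have i3 p : 0 <= \int[rho N.-1]_z Psi (y + pow p + z)%R by exact: integral_ge0.
have i4 p : 0 <= N%:R%:E * \int[rho N.-1]_z Psi (y + pow p + z)%R.
  by apply: mule_ge0 => //; rewrite lee_fin.
rewrite node_tonelli; last 2 first.
- apply: emeasurable_funM.
    by apply/measurable_EFinP; exact: measurable_funM.
  by apply: emeasurable_funD; [exact: emeasurable_funD|exact: emeasurable_funM].
- move=> p; rewrite mule_ge0 ?lee_fin ?mulr_ge0//.
  by apply: adde_ge0 => //; exact: adde_ge0.
transitivity (\int[mu3]_p (c%:E * ((w p)%:E * \int[rho N]_z H (y + pow p + z)%R +
   ((w p)%:E * \int[rho N]_z Phi p (y + z)%R +
    N%:R%:E * ((w p)%:E * \int[rho N.-1]_z Psi (y + pow p + z)%R))))).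
  apply: eq_integral => p _; rewrite /h EFinM -muleA; congr (_ * _).
  rewrite (muleCA N%:R%:E).
  have dist (a b e : \bar R) : 0 <= a -> 0 <= b -> 0 <= e ->
      (w p)%:E * (a + b + e) = (w p)%:E * a + ((w p)%:E * b + (w p)%:E * e).
    by move=> a0 b0 e0; rewrite !ge0_muleDr ?adde_ge0// addeA.
  by apply: dist; [exact: i1|exact: i2|exact: i4].
have k1 p : 0 <= (w p)%:E * \int[rho N]_z H (y + pow p + z)%R.
  by apply: mule_ge0 => //; rewrite lee_fin.
have k2 p : 0 <= (w p)%:E * \int[rho N]_z Phi p (y + z)%R.
  by apply: mule_ge0 => //; rewrite lee_fin.
have k3 p : 0 <= (w p)%:E * \int[rho N.-1]_z Psi (y + pow p + z)%R.
  by apply: mule_ge0 => //; rewrite lee_fin.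
have mk1 := emeasurable_funM mwE mi1.
have mk2 := emeasurable_funM mwE mi2.
have mk3 := emeasurable_funM mwE mi3.
have mk4 : measurable_fun [set: nodeT] (fun p => N%:R%:E * ((w p)%:E * \int[rho N.-1]_z Psi (y + pow p + z)%R)).
  exact: emeasurable_funM.
have k4 p : 0 <= N%:R%:E * ((w p)%:E * \int[rho N.-1]_z Psi (y + pow p + z)%R).
  by rewrite mule_ge0.
rewrite ge0_integralZl//; last 2 first.
- by apply: emeasurable_funD => //; exact: emeasurable_funD.
- by move=> p _; apply: adde_ge0 => //; exact: adde_ge0.
congr (_ * _).
rewrite ge0_integralD//; last 2 first.
- by move=> p _; rewrite adde_ge0.
- exact: emeasurable_funD.
rewrite ge0_integralD// ge0_integralZl//.
congr (_ + _).
  rewrite (rho_S N (mshiftD y mH) (fun z => H0 _)).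
  by apply: eq_integral => p _; congr (_ * _); apply: eq_integral => z _; rewrite addrA.
(* The contribution of the node just integrated: exchanging the integrals gives its mean score
   against [N] others. *)
have -> : \int[mu3]_p ((w p)%:E * \int[rho N]_z Phi p (y + z)%R) = \int[rho N]_z Psi (y + z)%R.
  pose K (q : nodeT * measurableTypeR R) := (w q.1)%:E * Phi q.1 (y + q.2)%R.
  have K0 q : 0 <= K q by rewrite mule_ge0 ?lee_fin.
  have mK : measurable_fun setT K.
    apply: emeasurable_funM; first by apply/measurable_EFinP; exact: (measurableT_comp mw).
    apply: (@measurableT_comp _ _ _ _ _ _ (fun q : ((R * R) * R) * R => Phi q.1 q.2) _ (fun q : ((R * R) * R) * R => (q.1, y + q.2)%R)) => //.
    by apply: measurable_fun_pair => //; exact: measurable_funD.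
  rewrite -[RHS](@fubini_tonelli2 _ _ nodeT (measurableTypeR R) R mu3 (rho N) K)//.
  rewrite fubini_tonelli1//; apply: eq_integral => p _.
  by rewrite /fubini_F /K/= ge0_integralZl// ?lee_fin//; apply: mshiftD; exact: mPhip.
(* For [N = 0] the factor [N] removes the term in [rho N.-1]. Otherwise [rho_S] raises that measure
   by one node, and the sum of the two contributions is counted by the successor. *)
case: N {IH h E mi1 mi2 mi3 i1 i2 i3 i4 k1 k2 k3 mk1 mk2 mk3 mk4 k4} => [|N].
  by rewrite mul0e adde0 mul1e.
have -> : \int[mu3]_p ((w p)%:E * \int[rho N]_z Psi (y + pow p + z)%R) =
    \int[rho N.+1]_z Psi (y + z)%R.
  rewrite (rho_S N (mshiftD y measurable_mean) (fun z => Psi0 _)).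
  by apply: eq_integral => p _; congr (_ * _); apply: eq_integral => z _; rewrite addrA.
rewrite -{1}[X in X + _]mul1e -ge0_muleDl ?lee_fin//.
Qed.

End ppp.

(** * Derivatives of Laplace transforms *)

Section laplace.
Context d (Y : measurableType d) (R : realType) (rho : {measure set Y -> \bar R}).
Variables (B : set Y) (v : Y -> R).
Hypotheses (mB : measurable B) (rhoB : (rho B < +oo)%E).
Hypotheses (mv : measurable_fun B v) (v0 : forall y, B y -> 0 <= v y).

Let f k (s : R) (y : Y) := v y ^+ k * expR (- (s * v y)).

Definition laplace_moment k (s : R) : R :=
  \int[rho]_(y in B) (v y ^+ k * expR (- (s * v y))).

Let f_le k (s : R) y : 0 < s -> B y -> f k s y <= k`!%:R / s ^+ k.
Proof. by move=> s0 By; apply: exprn_expR_le => //; exact: v0. Qed.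

Let f_ge0 k (s : R) y : B y -> 0 <= f k s y.
Proof. by move=> By; rewrite mulr_ge0 ?expR_ge0// exprn_ge0// v0. Qed.

(** The integrand is bounded by the constant [k! / s^k], and the measure of [B] is finite. *)
Lemma integrable_laplace k (s : R) : 0 < s -> rho.-integrable B (EFin \o f k s).
Proof.
move=> s0; have mf : measurable_fun B (EFin \o f k s).
  apply/measurable_EFinP; apply: measurable_funM; first exact: measurable_funX.
  apply: (measurableT_comp (@measurable_expR R)); apply: measurableT_comp => //.
  exact: measurable_funM.
apply/integrableP; split => //.
apply: (@le_lt_trans _ _ (\int[rho]_(y in B) (k`!%:R / s ^+ k)%:E)%E).
  apply: ge0_le_integral => //.
  - exact: measurableT_comp.
  - by move=> y By /=; rewrite lee_fin ger0_norm ?f_ge0// f_le.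
rewrite integral_cst//; apply: lte_mul_pinfty => //.
by rewrite lee_fin divr_ge0// exprn_ge0// ltW.
Qed.

Let is_derive_f k (s : R) y : is_derive s 1 (fun s => f k s y) (- f k.+1 s y).
Proof.
rewrite /f; apply: is_derive_eq; rewrite /GRing.scale/= exprS; ring.
Qed.

Lemma is_derive_laplace k (s : R) : 0 < s ->
  is_derive s 1 (laplace_moment k) (- laplace_moment k.+1 s).
Proof.
move=> s0.
have s2 : 0 < s / 2 by rewrite divr_gt0.
(* The lower end [s / 2] stays away from 0, so one constant, [G], dominates the derivative on the
   whole neighbourhood. *)
have sI : `]s / 2, s + 1[%classic s by rewrite /= in_itv/=; apply/andP; split; lra.
have Ipos (x : R) : `]s / 2, s + 1[%classic x -> 0 < x.
  by rewrite /= in_itv/= => /andP[+ _]; exact: lt_trans.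
pose G (y : Y) : R := (k.+1)`!%:R / (s / 2) ^+ k.+1.
have G0 y : 0 <= G y by rewrite divr_ge0// exprn_ge0// ltW.
have iG : rho.-integrable B (EFin \o G).
  apply/integrableP; split; first by apply/measurable_EFinP; exact: measurable_cst.
  rewrite (eq_integral (cst ((k.+1)`!%:R / (s / 2) ^+ k.+1)%:E)); last first.
    by move=> y _ /=; rewrite ger0_norm// G0.
  by rewrite integral_cst//; apply: lte_mul_pinfty => //; rewrite lee_fin (G0 point).
have df (x : R) y : `]s / 2, s + 1[%classic x -> B y -> derivable ((f k)^~ y) x 1.
  by move=> _ _; have [] := is_derive_f k x y.
have d1f x y : partial1of2 (f k) x y = - f k.+1 x y.
  by rewrite partial1of2E; have [_ ->] := is_derive_f k x y.
have G_ub (x : R) y : `]s / 2, s + 1[%classic x -> B y -> `|partial1of2 (f k) x y| <= G y.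
  move=> Ix By; rewrite d1f normrN ger0_norm ?f_ge0//.
  apply: le_trans (f_le k.+1 s2 By).
  rewrite /f ler_wpM2l ?exprn_ge0 ?v0// ler_expR lerN2 ler_wpM2r ?v0//.
  by move: Ix; rewrite /= in_itv/= => /andP[/ltW].
have intf (x : R) : `]s / 2, s + 1[%classic x -> rho.-integrable B (EFin \o f k x).
  by move=> /Ipos; exact: integrable_laplace.
apply: DeriveDef.
  exact: (derivable_under_integral mB sI intf df G0 iG G_ub).
rewrite -derive1E (differentiation_under_integral mB sI intf df G0 iG G_ub).
under eq_Rintegral do rewrite d1f -mulN1r.
rewrite RintegralZl//; last exact: integrable_laplace.
by rewrite mulN1r.
Qed.

(** Agreement for [s > 0] is enough, since every positive [s] has a neighbourhood of positive
    numbers on which the induction hypothesis holds. *)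
Lemma derive1n_laplace (L : R -> R) :
  (forall s : R, 0 < s -> L s = laplace_moment 0 s) ->
  forall k (s : R), 0 < s -> derive1n k L s = (-1) ^+ k * laplace_moment k s.
Proof.
move=> LE; elim=> [|k IH] s s0; first by rewrite /= LE// expr0 mul1r.
rewrite derive1nS derive1E.
have h : is_derive s 1 (fun s : R => (-1) ^+ k * laplace_moment k s) ((-1) ^+ k.+1 * laplace_moment k.+1 s).
  have dl := is_derive_laplace k s0.
  by apply: is_derive_eq; rewrite /GRing.scale/= exprS; ring.
rewrite (@near_eq_derive _ _ _ _ (fun s : R => (-1) ^+ k * laplace_moment k s)); first by have [_ ->] := h.
near=> t; apply: IH; near: t; exact: lt_nbhsr.
Unshelve. all: end_near. Qed.

End laplace.

(** * The law of the interference *)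

Section node_integral.
Local Open Scope ereal_scope.
Context (R : realType).
Notation mu := (@lebesgue_measure R).
Variables (c h Rad : R) (m : nat) (cmu : R * R).
Hypotheses (c0 : (0 <= c)%R) (h0 : (0 < h)%R) (Rad0 : (0 < Rad)%R).

Definition node_weight (p : (R * R) * R) : R :=
  (c * (in_disk cmu Rad p.1)%:R * gamma_pdf m p.2)%R.

Lemma node_weight_ge0 p : (0 <= node_weight p)%R.
Proof. by rewrite mulr_ge0 ?gamma_pdf_ge0// mulr_ge0. Qed.

Lemma measurable_node_weight : measurable_fun setT node_weight.
Proof.
apply: measurable_funM.
  apply: measurable_funM => //; apply/measurable_EFinP.
  apply: measurable_boolr_EFin.
  exact: (measurableT_comp (@measurable_in_disk R cmu Rad)).
exact: (measurableT_comp (@measurable_gamma_pdf R m)).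
Qed.

Let d := Num.sqrt (h ^+ 2 + Rad ^+ 2).

(** At a fixed position the gain is integrated first; what remains depends on the position only
    through the UAV distance and the two disk tests. *)
Lemma integral_node_lens (Rmse : R) (cmse : R * R) (K : R -> R -> \bar R) :
  (0 < Rmse)%R -> dist2 cmse cmu = Rad ->
  measurable_fun setT (fun q : R * R => K q.1 q.2) -> (forall r g, 0 <= K r g) ->
  \int[@mu3 R]_p ((node_weight p)%:E *
    ((in_disk cmse Rmse p.1)%:R%:E * K (uav_dist h cmu p.1) p.2)) =
  c%:E * \int[mu]_(r in `]h, d])
    (\int[mu]_g ((gamma_pdf m g)%:E * K r g) * (r * lens_angle h Rad Rmse r)%R%:E).
Proof.
move=> Rmse0 cc mK K0.
have mgK : measurable_fun setT (fun q : R * R => (gamma_pdf m q.2)%:E * K q.1 q.2).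
  apply: emeasurable_funM => //; apply/measurable_EFinP.
  exact: (measurableT_comp (@measurable_gamma_pdf R m)).
have gK0 r g : 0 <= (gamma_pdf m g)%:E * K r g.
  by rewrite mule_ge0// lee_fin gamma_pdf_ge0.
pose I r := \int[mu]_g ((gamma_pdf m g)%:E * K r g).
have I0 r : 0 <= I r by exact: integral_ge0.
have mI : measurable_fun [set: R] I.
  exact: (@measurable_lebesgue_integral R (fun r g => (gamma_pdf m g)%:E * K r g)).
have mX : measurable_fun setT (fun p : (R * R) * R => (node_weight p)%:E *
    ((in_disk cmse Rmse p.1)%:R%:E * K (uav_dist h cmu p.1) p.2)).
  apply: emeasurable_funM; first by apply/measurable_EFinP; exact: measurable_node_weight.
  apply: emeasurable_funM.
    apply: measurable_boolr_EFin.
    exact: (measurableT_comp (@measurable_in_disk R cmse Rmse)).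
  apply: (@measurableT_comp _ _ _ _ _ _ (fun q : R * R => K q.1 q.2) _
     (fun p : (R * R) * R => (uav_dist h cmu p.1, p.2))) => //.
  apply: measurable_fun_pair => //.
  exact: (measurableT_comp (@measurable_uav_dist R h cmu)).
rewrite -(node_tonelli mX); last first.
  by move=> p; rewrite mule_ge0 ?lee_fin ?node_weight_ge0// mule_ge0// lee_fin.
transitivity (\int[mu]_x1 \int[mu]_x2 ((c%:E * I (uav_dist h cmu (x1, x2))) *
    (in_disk cmse Rmse (x1, x2) && in_disk cmu Rad (x1, x2))%:R%:E)).
  apply: eq_integral => x1 _; apply: eq_integral => x2 _.
  set b' := in_disk cmse _ _; set b := in_disk cmu _ _.
  transitivity (\int[mu]_g ((c * (b' && b)%:R)%R%:E *
    ((gamma_pdf m g)%:E * K (uav_dist h cmu (x1, x2)) g))).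
    apply: eq_integral => g _; rewrite /node_weight/= -/b.
    case: b'; case: b; rewrite ?mulr1 ?mulr0 ?mul0r ?mul0e ?mule0 ?mul1e//=.
    by rewrite EFinM muleA.
  rewrite ge0_integralZl ?lee_fin ?mulr_ge0//; last first.
    exact: (measurable_fun_pair2 (uav_dist h cmu (x1, x2)) mgK).
  by rewrite -/(I _) EFinM muleAC.
rewrite (@ge0_integral_lens R h Rad Rmse cmu cmse h0 Rad0 Rmse0 cc (fun r => c%:E * I r)); last 2 first.
- exact: emeasurable_funM.
- by move=> r; rewrite mule_ge0.
under eq_integral do rewrite -muleA.
rewrite ge0_integralZl//.
- apply: measurable_funTS; apply: emeasurable_funM; first exact: mI.
  apply/measurable_EFinP; apply: measurable_funM => //.
  exact: measurable_lens_angle.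
- move=> r; rewrite /= in_itv/= => /andP[hr _].
  by rewrite mule_ge0// lee_fin mulr_ge0 ?lens_angle_ge0// ltW// (lt_trans h0).
Qed.

(* A disk of radius [2 * Rad] around a boundary point contains the whole disk. *)
Lemma integral_node_disk (K : R -> R -> \bar R) :
  measurable_fun setT (fun q : R * R => K q.1 q.2) -> (forall r g, 0 <= K r g) ->
  \int[@mu3 R]_p ((node_weight p)%:E * K (uav_dist h cmu p.1) p.2) =
  c%:E * \int[mu]_(r in `]h, d])
    (\int[mu]_g ((gamma_pdf m g)%:E * K r g) * (r * (2 * pi))%R%:E).
Proof.
move=> mK K0.
pose cm : R * R := (cmu.1 + Rad, cmu.2)%R.
have cc : dist2 cm cmu = Rad.
  rewrite /dist2 /cm/= subrr expr0n addr0 (addrC cmu.1) addrK sqrtr_sqr.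
  by rewrite gtr0_norm.
have R20 : (0 < 2 * Rad)%R by rewrite mulr_gt0.
have := @integral_node_lens (2 * Rad)%R cm K R20 cc mK K0.
have -> : \int[mu]_(r in `]h, d]) (\int[mu]_g ((gamma_pdf m g)%:E * K r g) *
    (r * lens_angle h Rad (2 * Rad) r)%R%:E) =
  \int[mu]_(r in `]h, d]) (\int[mu]_g ((gamma_pdf m g)%:E * K r g) * (r * (2 * pi))%R%:E).
  apply: eq_integral => r; rewrite inE/= in_itv/= => /andP[hr rd].
  (* For [r <= d] the ground distance is at most [Rad = 2 * Rad - Rad], which is the full-turn
     branch of [theta]. *)
  rewrite -theta_lens_angle// /theta sqrtr_ge0/=.
  suff -> : (Num.sqrt (r ^+ 2 - h ^+ 2) <= Num.max 0 (2 * Rad - Rad))%R by [].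
  rewrite le_max; apply/orP; right.
  have -> : (2 * Rad - Rad = Rad)%R by ring.
  have r0 : (0 < r)%R by exact: lt_trans hr.
  rewrite -(gtr0_norm Rad0) -(sqrtr_sqr Rad) ler_sqrt ?sqr_ge0// lerBlDl.
  rewrite -(@sqr_sqrtr _ (h ^+ 2 + Rad ^+ 2)) ?addr_ge0 ?sqr_ge0//.
  by rewrite ler_pXn2r ?nnegrE ?sqrtr_ge0 ?(ltW r0).
move=> <-; apply: eq_integral => p _.
case: (boolP (in_disk cm (2 * Rad) p.1)) => [_|pn]; first by rewrite mul1e.
rewrite /node_weight; suff -> : in_disk cmu Rad p.1 = false.
  by rewrite mulr0 mul0r !mul0e.
apply/negbTE; apply: contra pn; rewrite /in_disk => pR.
have pR2 : (dist2 p.1 cmu ^+ 2 <= Rad ^+ 2)%R.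
  by rewrite ler_pXn2r ?nnegrE ?sqrtr_ge0 ?(ltW Rad0).
rewrite -(ler_pXn2r (ltn0Sn 1)) ?nnegrE ?sqrtr_ge0 ?(ltW R20)//.
move: pR2; rewrite !dist2_sqr /cm/=.
move: p.1 => [x y] /=; move: cmu => [x0 y0] /= => H.
(* Parallelogram identity: with [X = x - x0], the squares of [X - Rad] and [X + Rad] add up to
   [2 X^2 + 2 Rad^2]. *)
have := sqr_ge0 (x - x0 + Rad)%R; have := sqr_ge0 (y - y0)%R; lra.
Qed.

End node_integral.

(** * Poisson mixtures of measures *)

Section exponential_mixture.
Local Open Scope ereal_scope.
Context (R : realType).

Lemma nneseries_expR (x : R) : (0 <= x)%R ->
  \sum_(N <oo) (x ^+ N / N`!%:R)%:E = (expR x)%:E.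
Proof.
move=> x0; apply/cvg_lim => //.
rewrite [X in X @ _](_ : _ = EFin \o series (exp_coeff x)).
  by apply: cvg_EFin; [exact: nearW|exact: is_cvg_series_exp_coeff].
by apply/funext => n /=; rewrite sumEFin.
Qed.

Lemma poisson_series (L x : R) : (0 <= x)%R ->
  \sum_(N <oo) ((expR (- L) / N`!%:R)%:E * (x ^+ N)%:E) = (expR (x - L))%:E.
Proof.
move=> x0; rewrite (eq_eseriesr (g := fun N => (expR (- L))%:E * (x ^+ N / N`!%:R)%:E)).
  rewrite nneseriesZl; last by move=> N _; rewrite lee_fin divr_ge0// exprn_ge0.
  by rewrite nneseries_expR// -EFinM -expRD addrC.
by move=> N _; rewrite -!EFinM; congr EFin; ring.
Qed.

(** As [rho N] has mass [L^N], the exponential series gives the mixture mass [e^(L - L) = 1]. *)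
Lemma poisson_mixture_exists (rho : nat -> {finite_measure set (measurableTypeR R) -> \bar R})
    (L : R) :
  (0 <= L)%R -> (forall N, rho N setT = (L ^+ N)%:E) ->
  exists2 mix : {finite_measure set (measurableTypeR R) -> \bar R},
    forall A, mix A = \sum_(N <oo) ((expR (- L) / N`!%:R)%:E * rho N A) &
    forall H : R -> \bar R, measurable_fun setT H -> (forall y, 0 <= H y) ->
    \int[mix]_z H z = \sum_(N <oo) ((expR (- L) / N`!%:R)%:E * \int[rho N]_z H z).
Proof.
move=> L0 rhoT.
have cN0 N : (0 <= expR (- L) / N`!%:R)%R by rewrite divr_ge0 ?expR_ge0.
pose ms N : {measure set (measurableTypeR R) -> \bar R} := mscale (NngNum (cN0 N)) (rho N).
pose nu : {measure set (measurableTypeR R) -> \bar R} := mseries ms 0.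
have nuA A : nu A = \sum_(N <oo) ((expR (- L) / N`!%:R)%:E * rho N A) by [].
have fin : fin_num_fun nu.
  apply: lty_fin_num_fun; rewrite nuA.
  by under eq_eseriesr do rewrite rhoT; rewrite poisson_series// ltry.
exists (finite_measure_of fin) => // H mH H0.
have := @ge0_integral_measure_series _ (measurableTypeR R) R ms setT measurableT H.
move=> -> //; apply: eq_eseriesr => N _.
by rewrite ge0_integral_mscale.
Qed.

End exponential_mixture.

(** [powR] with exponent -1 is the inverse on nonnegative numbers, hence the detour through [x^2];
    at 0 both sides are 0. *)
Lemma measurable_invr (R : realType) : measurable_fun [set: R] (fun x : R => x^-1).
Proof.
have -> : (fun x : R => x^-1) = (fun x : R => x * (x ^+ 2) `^ (-1)).
  apply/funext => x; rewrite powR_inv1 ?sqr_ge0//.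
  have [->|x0] := eqVneq x 0; first by rewrite invr0 mul0r.
  by field.
apply: measurable_funM => //.
by apply: (measurableT_comp (@measurable_powR R (-1))); exact: exprn_measurable.
Qed.

Lemma eseries_shift (R : realType) (f : nat -> \bar R) : f 0%N = 0%E ->
  (forall n, 0 <= f n)%E -> (\sum_(n <oo) f n = \sum_(n <oo) f n.+1)%E.
Proof.
move=> f0 f_ge0; apply/cvg_lim => //; rewrite -cvg_shiftS /=.
under eq_fun do rewrite big_nat_recl// f0 add0e.
by apply: is_cvg_nneseries => n _.
Qed.

(** * The interference of the model and the success probability *)

Section assembly.
Context (R : realType).
Notation mu := (@lebesgue_measure R).
Variables (lam a P sigma2 eta h Rad Rmse beta : R) (m : nat) (cmu cmse : R * R).
Hypotheses (lam0 : 0 < lam) (a0 : 0 < a) (P0 : 0 < P) (sigma20 : 0 < sigma2).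
Hypotheses (h0 : 0 < h) (Rad0 : 0 < Rad) (Rmse0 : 0 < Rmse) (beta0 : 0 < beta).
Hypotheses (m0 : (0 < m)%N) (cc : dist2 cmse cmu = Rad).

Let c := a * lam.
Let c0 : 0 <= c. Proof. by rewrite mulr_ge0// ltW. Qed.
Let d := Num.sqrt (h ^+ 2 + Rad ^+ 2).
Let w := node_weight c Rad m cmu.
Let pow : (R * R) * R -> R := rx_power P eta h cmu.
Let w0 p : 0 <= w p. Proof. exact: node_weight_ge0. Qed.
Let mw : measurable_fun setT w. Proof. exact: measurable_node_weight. Qed.
Let mR0 : 0 < m%:R :> R. Proof. by rewrite ltr0n. Qed.

Let mpow : measurable_fun setT pow.
Proof.
apply: measurable_funM; first by apply: measurable_funM.
apply: (measurableT_comp (@measurable_powR R (- eta))).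
exact: (measurableT_comp (@measurable_uav_dist R h cmu)).
Qed.

Let Phi (p : (R * R) * R) (y : R) : \bar R :=
  ([&& in_disk cmse Rmse p.1, in_disk cmu Rad p.1 &
       beta <= pow p / (y + sigma2)])%:R%:E.

Let Phi0 p y : (0 <= Phi p y)%E. Proof. by rewrite lee_fin. Qed.

Let mPhi : measurable_fun setT (fun q : ((R * R) * R) * R => Phi q.1 q.2).
Proof.
have m11 : measurable_fun setT (fun q : ((R * R) * R) * R => q.1.1).
  by apply: (measurableT_comp measurable_fst); exact: measurable_fst.
apply: measurable_boolr_EFin; apply: measurable_and.
  exact: (measurableT_comp (@measurable_in_disk R cmse Rmse) m11).
apply: measurable_and.
  exact: (measurableT_comp (@measurable_in_disk R cmu Rad) m11).
apply: measurable_fun_ler => //; apply: measurable_funM.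
  exact: (measurableT_comp mpow).
apply: (measurableT_comp (@measurable_invr R)).
exact: measurable_funD.
Qed.

(** [v y] is the normalized interference-plus-noise for received interference power [y], and [E y r]
    the conditional success probability of a node at UAV distance [r]. *)
Let v (y : R) := (y + sigma2) / P.
Let E (y r : R) : R := erlang_tail m m%:R (beta * r `^ eta * v y).

Local Open Scope ereal_scope.

(** At distance [r] the SINR test is equivalent to [g >= beta r^eta v y], so the gain integrates to
    an Erlang tail. *)
Let mean_success (y : R) : (0 <= y)%R ->
  \int[@mu3 R]_p ((w p)%:E * Phi p y) =
  c%:E * \int[mu]_(r in `]h, d]) ((E y r)%:E * (r * lens_angle h Rad Rmse r)%R%:E).
Proof.
move=> y0; have ys : (0 < y + sigma2)%R by rewrite ltr_wpDl.
pose K (r g : R) : \bar R := (beta <= P * g * r `^ (- eta) / (y + sigma2))%R%:R%:E.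
transitivity (\int[@mu3 R]_p ((w p)%:E *
    ((in_disk cmse Rmse p.1)%:R%:E * K (uav_dist h cmu p.1) p.2))).
  apply: eq_integral => p _; rewrite /Phi /K /w /node_weight /pow /rx_power.
  case: (in_disk cmse Rmse p.1) => /=; last by rewrite mul0e.
  case: (in_disk cmu Rad p.1) => /=; last by rewrite mulr0 mul0r !mul0e.
  by rewrite mul1e.
rewrite (@integral_node_lens R c h Rad m cmu c0 h0 Rad0 Rmse cmse)//; last 2 first.
- apply: measurable_boolr_EFin; apply: measurable_fun_ler => //.
  apply: measurable_funM => //; apply: measurable_funM; first exact: measurable_funM.
  exact: (measurableT_comp (@measurable_powR R (- eta))).
- by move=> r g; rewrite lee_fin.
congr (_ * _); apply: eq_integral => r; rewrite inE/= in_itv/= => /andP[hr _].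
have r0 : (0 < r)%R by exact: lt_trans hr.
have re0 : (0 < r `^ eta)%R by exact: powR_gt0.
congr (_ * _); rewrite /E -integral_gamma_pdf_tail//; last first.
  by rewrite !mulr_gt0// invr_gt0.
apply: eq_integral => g _; congr (_ * _%:R%:E); rewrite powRN.
rewrite ler_pdivlMr// ler_pdivlMr// /v mulrA ler_pdivrMr//.
by rewrite (mulrC g) -!mulrA (mulrC (y + sigma2)%R).
Qed.

Let q (s r : R) : R := ((1 + s * r `^ (- eta) / m%:R) ^+ m)^-1.

Let q_base (s r : R) : (0 <= s)%R -> (1 <= 1 + s * r `^ (- eta) / m%:R)%R.
Proof. by move=> s0; rewrite lerDl divr_ge0 ?ler0n// mulr_ge0// powR_ge0. Qed.

Let q_ge0 (s r : R) : (0 <= s)%R -> (0 <= q s r)%R.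
Proof. by move=> s0; rewrite invr_ge0 exprn_ge0// (le_trans _ (q_base r s0)). Qed.

Let q_le1 (s r : R) : (0 <= s)%R -> (q s r <= 1)%R.
Proof.
move=> s0; rewrite invf_le1; first exact: exprn_ege1 (q_base r s0).
by rewrite exprn_gt0// (lt_le_trans _ (q_base r s0)).
Qed.

Let mq (s : R) : measurable_fun setT (q s).
Proof.
apply: (measurableT_comp (@measurable_invr R)); apply: measurable_funX.
apply: measurable_funD => //; apply: measurable_funM => //.
by apply: measurable_funM => //; exact: measurable_powR.
Qed.

Let hd : (h < d)%R.
Proof.
rewrite -{1}(gtr0_norm h0) -sqrtr_sqr /d ltr_sqrt.
  by rewrite ltrDl exprn_gt0.
by rewrite addr_gt0// exprn_gt0.
Qed.

Let Iq (s : R) : R := \int[mu]_(r in `[h, d]) (q s r * r).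
Let Ir : R := \int[mu]_(r in `[h, d]) r.

Let integrable_id : mu.-integrable `[h, d] (EFin \o (id : R -> R)).
Proof.
apply: continuous_compact_integrable; first exact: segment_compact.
by apply: continuous_subspaceT => x; exact: cvg_id.
Qed.

Let integrable_q (s : R) : (0 <= s)%R -> mu.-integrable `[h, d] (EFin \o (fun r => q s r * r)%R).
Proof.
move=> s0; apply: (le_integrable _ _ _ integrable_id) => //.
  apply/measurable_EFinP; apply: measurable_funTS.
  by apply: measurable_funM => //; exact: mq.
move=> r _ /=; rewrite lee_fin normrM ler_piMl// ger0_norm ?q_ge0//.
exact: q_le1.
Qed.

(** [2 pi Ir] is the area of the disk. This reconciles the Janossy constant [L] with the radial
    integral in [LI]. *)
Let Ir_val : (2 * Ir = Rad ^+ 2)%R.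
Proof.
rewrite /Ir /Rintegral (@continuous_FTC2 _ _ (fun r : R => r ^+ 2 / 2)%R)//.
- by rewrite /= /d sqr_sqrtr ?addr_ge0 ?sqr_ge0//; field.
- by apply: continuous_subspaceT => x; exact: cvg_id.
- have cv (x : R) : {for x, continuous (fun r : R => r ^+ 2 / 2)%R}.
    by apply: cvgM; [exact: exprn_continuous|exact: cvg_cst].
  split; first by move=> x _; exact: ex_derive.
    by apply: cvg_at_right_filter; exact: cv.
  by apply: cvg_at_left_filter; exact: cv.
- move=> x _; rewrite derive1E; apply: derive_val.
  by apply: is_derive_eq; rewrite /GRing.scale/=; field.
Qed.

Let L := (c * pi * Rad ^+ 2)%R.
Let ell (s : R) : R := (c * (2 * pi) * Iq s)%R.

Let L0 : (0 <= L)%R. Proof. by rewrite mulr_ge0 ?sqr_ge0// mulr_ge0// pi_ge0. Qed.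

Let ell_ge0 (s : R) : (0 <= s)%R -> (0 <= ell s)%R.
Proof.
move=> s0; rewrite mulr_ge0//; first by rewrite mulr_ge0// mulr_ge0// pi_ge0.
apply: Rintegral_ge0 => r.
rewrite /= in_itv/= => /andP[hr _].
by rewrite mulr_ge0 ?q_ge0// (le_trans _ hr)// ltW.
Qed.

(** Each convolution multiplies the transform by [ell s]; at [s = 0] this is the mass [L] of the
    intensity measure. *)
Let weight_laplace (s : R) : (0 <= s)%R ->
  \int[@mu3 R]_p ((w p)%:E * (expR (- (s * (pow p / P))))%:E) = (ell s)%:E.
Proof.
move=> s0.
pose K (r g : R) : \bar R := (expR (- (s * (r `^ (- eta)) * g)))%:E.
transitivity (\int[@mu3 R]_p ((w p)%:E * K (uav_dist h cmu p.1) p.2)).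
  apply: eq_integral => p _; congr (_ * (expR (- _))%:E).
  by rewrite /pow /rx_power; field; rewrite gt_eqF.
rewrite (@integral_node_disk R c h Rad m cmu c0 h0 Rad0); last 2 first.
- apply/measurable_EFinP; apply: (measurableT_comp (@measurable_expR R)).
  apply: measurableT_comp => //; apply: measurable_funM => //; apply: measurable_funM => //.
  exact: (measurableT_comp (@measurable_powR R (- eta))).
- by move=> r g; rewrite lee_fin expR_ge0.
transitivity (c%:E * \int[mu]_(r in `]h, d]) ((2 * pi) * (q s r * r))%R%:E).
  congr (_ * _); apply: eq_integral => r _.
  rewrite integral_gamma_pdf_expR ?mulr_ge0 ?powR_ge0// -EFinM; congr EFin.
  by rewrite /q; ring.
rewrite integral_itv_obnd_cbnd; last first.
  apply: measurable_funTS; apply/measurable_EFinP; apply: measurable_funM => //.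
  by apply: measurable_funM => //; exact: mq.
under eq_integral do rewrite EFinM.
rewrite integralZl//; last exact: integrable_q.
by rewrite /ell /Iq /Rintegral !EFinM muleA fineK//; apply: integrable_fin_num => //; exact: integrable_q.
Qed.

Let ell0 : ell 0 = L.
Proof.
rewrite /ell /L -Ir_val /Iq /Ir; under eq_Rintegral do rewrite /q !mul0r addr0 expr1n invr1 mul1r.
by ring.
Qed.

Let wfin : \int[@mu3 R]_p (w p)%:E < +oo.
Proof.
have := weight_laplace (lexx 0); under eq_integral do rewrite mul0r oppr0 expR0 mule1.
by move=> ->; rewrite ltry.
Qed.

(** Negative gains would give negative powers, but the weight vanishes there. *)
Let pow_ge0 p : (w p != 0)%R -> (0 <= pow p)%R.
Proof.
rewrite /w /node_weight /gamma_pdf; case: ifPn => [g0 _|_]; last by rewrite mulr0 eqxx.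
by rewrite /pow /rx_power !mulr_ge0 ?powR_ge0// ltW.
Qed.

Let Psi (y : R) := \int[@mu3 R]_p ((w p)%:E * Phi p y).

Lemma success_countE (s : seq (@node R)) :
  (success_count P sigma2 eta h beta cmu Rad cmse Rmse s)%:E =
  leave_one_out_sum pow Phi s 0%R.
Proof.
rewrite /success_count /leave_one_out_sum -sumEFin; apply: eq_bigr => n _.
by rewrite /Phi /SINR add0r.
Qed.

Lemma LI_expR (s : R) : (0 < s)%R ->
  LI lam a P sigma2 eta h d m s = (expR (- (s * sigma2 / P)) * expR (ell s - L))%R.
Proof.
move=> s0; rewrite /LI; congr (_ * expR _)%R.
have -> : (\int[mu]_(r in `[h, d]) ((1 - q s r) * r) = Ir - Iq s)%R.
  rewrite /Ir /Iq -RintegralB//; last exact: integrable_q (ltW s0).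
  by apply: eq_Rintegral => r _; ring.
rewrite /ell /L -Ir_val /c; ring.
Qed.

Let B : set R := `[0%R, +oo[%classic.

Let mv : measurable_fun setT v.
Proof. by apply: measurable_funM => //; exact: measurable_funD. Qed.

Let v_ge0 y : B y -> (0 <= v y)%R.
Proof.
rewrite /B/= in_itv/= andbT => y0.
by rewrite divr_ge0 ?addr_ge0 ?(ltW sigma20) ?(ltW P0).
Qed.

Let mexp (s : R) : measurable_fun setT (fun z : R => (expR (- (s * (z / P))))%:E).
Proof.
apply/measurable_EFinP; apply: (measurableT_comp (@measurable_expR R)).
by apply: measurableT_comp => //; apply: measurable_funM => //; exact: measurable_funM.
Qed.

Lemma interference_law_exists :
  exists mix : {finite_measure set (measurableTypeR R) -> \bar R},
  [/\ forall s : R, (0 <= s)%R ->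
        \int[mix]_z (expR (- (s * (z / P))))%:E = (expR (ell s - L))%:E,
      forall H : R -> \bar R, measurable_fun setT H -> (forall y, 0 <= H y) ->
        \int[mix]_z H z = \int[mix]_(z in B) H z &
      ppp_disk_expect (a * lam) cmu Rad m
        (success_count P sigma2 eta h beta cmu Rad cmse Rmse) = \int[mix]_z Psi z].
Proof.
have [rho [rho_0 rho_S]] := shot_measures_exist mw w0 mpow wfin.
have lap N (s : R) : (0 <= s)%R ->
    \int[rho N]_z (expR (- (s * (z / P))))%:E = (ell s ^+ N)%:E.
  move=> s0; elim: N => [|N IH].
    by rewrite (rho_0 _ (mexp s)) mul0r mulr0 oppr0 expR0 expr0.
  rewrite (rho_S N _ (mexp s)); last by move=> y; rewrite lee_fin expR_ge0.
  transitivity (\int[@mu3 R]_p ((w p)%:E * (expR (- (s * (pow p / P))))%:E * (ell s ^+ N)%:E)).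
    apply: eq_integral => p _; rewrite -muleA -IH; congr (_ * _).
    rewrite -ge0_integralZl//; try exact: mexp;
      try (by move=> z _; rewrite lee_fin expR_ge0); try by rewrite lee_fin expR_ge0.
    apply: eq_integral => z _; rewrite -EFinM -expRD; congr (expR _)%:E.
    by field; rewrite gt_eqF.
  have mwe : measurable_fun setT
      (fun p : (R * R) * R => (w p)%:E * (expR (- (s * (pow p / P))))%:E).
    apply: emeasurable_funM; first exact/measurable_EFinP.
    by apply: (@measurableT_comp _ _ _ _ _ _ (fun z : R => (expR (- (s * (z / P))))%:E)) => //; exact: mexp.
  rewrite ge0_integralZr//; try exact: mwe;
    try (by move=> p _; rewrite mule_ge0 ?lee_fin ?expR_ge0); try by rewrite lee_fin exprn_ge0// ell_ge0.
  by rewrite weight_laplace// -EFinM exprS.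
have rhoT N : rho N setT = (L ^+ N)%:E.
  rewrite -ell0 -(lap N _ (lexx 0)); under [RHS]eq_integral do rewrite mul0r oppr0 expR0.
  by rewrite integral_cst// mul1e.
have [mix mixA mixH] := poisson_mixture_exists L0 rhoT.
exists mix; split.
- move=> s s0; rewrite mixH; last 2 first.
  + exact: mexp.
  + by move=> y; rewrite lee_fin expR_ge0.
  by under eq_eseriesr do rewrite lap//; rewrite poisson_series// ell_ge0.
- pose ind (y z : R) : \bar R := (y + z < 0)%R%:R%:E.
  have mind y : measurable_fun [set: R] (ind y).
    by apply: measurable_boolr_EFin; apply: measurable_fun_ltr => //; exact: measurable_funD.
  have ind0 y z : 0 <= ind y z by rewrite lee_fin.
  (* Stated for all shifts [y >= 0] because the induction step replaces [y] by [y + pow p]. *)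
  have neg N : forall y, (0 <= y)%R -> \int[rho N]_z ind y z = 0.
    elim: N => [|N IH] y y0.
      by rewrite (rho_0 _ (mind y)) /ind addr0 ltNge y0.
    rewrite (rho_S N _ (mind y) (ind0 y)) integral0_eq// => p _.
    have [->|wp] := eqVneq (w p) 0%R; first by rewrite mul0e.
    rewrite [X in _ * X](_ : _ = \int[rho N]_z ind (y + pow p)%R z); last first.
      by apply: eq_integral => z _; rewrite /ind addrA.
    by rewrite IH ?mule0// addr_ge0// pow_ge0.
  have negN N : rho N (`]-oo, 0%R[%classic : set R) = 0.
    rewrite -(neg N _ (lexx 0)) -[LHS]mul1e -integral_cst//=.
    rewrite integral_mkcond; apply: eq_integral => z _.
    by rewrite patchE mem_setE in_itv/= /ind add0r; case: ifP.
  have mixN : mix (`]-oo, 0%R[%classic : set R) = 0.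
    by rewrite mixA; apply: eseries0 => N _ _; rewrite negN mule0.
  move=> H mH H0.
  rewrite (@ge0_negligible_integral _ _ _ mix setT `]-oo, 0%R[%classic)//.
  congr (integral _ _ _); apply/seteqP; split => z /=; rewrite /B/= !in_itv/= andbT.
    by move=> [_ /negP]; rewrite -leNgt.
  by move=> z0; split => //; apply/negP; rewrite -leNgt.
- have iterE N : iterint N (fun s => ((\prod_(p <- s) (a * lam * (in_disk cmu Rad p.1)%:R * gamma_pdf m p.2)) *
      success_count P sigma2 eta h beta cmu Rad cmse Rmse s)%R%:E) =
      N%:R%:E * \int[rho N.-1]_z Psi z.
    have := @iterint_leave_one_out R w pow mw w0 mpow rho rho_0 rho_S Phi mPhi Phi0
      N 1%R 0%R (cst 0) ler01 (measurable_cst _) (fun=> lexx 0).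
    rewrite mul1e integral0 add0e.
    have -> : \int[rho N.-1]_z \int[@mu3 R]_p ((w p)%:E * Phi p (0 + z)%R) = \int[rho N.-1]_z Psi z.
      by apply: eq_integral => z _; rewrite add0r.
    move=> <-; congr (iterint N _); apply/funext => s.
    by rewrite /= mul1r add0e -success_countE -EFinM.
  have Psi0 z : 0 <= Psi z.
    by apply: integral_ge0 => p _; rewrite mule_ge0 ?lee_fin.
  have X0 N : 0 <= \int[rho N]_z Psi z by exact: integral_ge0.
  rewrite /ppp_disk_expect mixH//; last exact: (@measurable_mean R w mw w0 Phi mPhi Phi0).
  under eq_eseriesr do rewrite iterE.
  (* The term [N = 0] vanishes and [N.+1 / (N.+1)! = 1 / N!], so the Poisson weights reappear on
     [rho N]. *)
  rewrite eseries_shift; last 2 first.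
  + by rewrite mul0e mule0.
  + by move=> N; rewrite mule_ge0 ?lee_fin ?divr_ge0 ?expR_ge0// mule_ge0.
  apply: eq_eseriesr => N _.
  rewrite muleA -EFinM; congr (_%:E * _).
  rewrite factS natrM -/c -/L; field.
  by rewrite pnatr_eq0 -lt0n fact_gt0/= gt_eqF// ltr_pwDl.
Qed.

Lemma measurable_erlang_tail_comp d' (T : measurableType d') (g : T -> R) :
  measurable_fun setT g -> measurable_fun setT (fun x => erlang_tail m m%:R (g x)).
Proof.
move=> mg; rewrite /erlang_tail; apply: measurable_sum => k.
have mmg : measurable_fun setT (fun x => m%:R * g x)%R by exact: measurable_funM.
apply: measurable_funM; first by apply: measurable_funM => //; exact: measurable_funX.
by apply: (measurableT_comp (@measurable_expR R)); exact: measurableT_comp.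
Qed.

Let E_ge0 y r : B y -> (0 <= E y r)%R.
Proof.
move=> By; rewrite /E /erlang_tail sumr_ge0// => k _.
rewrite mulr_ge0 ?expR_ge0// divr_ge0// exprn_ge0// mulr_ge0//.
by rewrite mulr_ge0 ?v_ge0// mulr_ge0 ?powR_ge0// ltW.
Qed.

Lemma success_probability :
  ppp_disk_expect (a * lam) cmu Rad m
    (success_count P sigma2 eta h beta cmu Rad cmse Rmse) =
  (a * lam)%:E * \int[mu]_(r in `[h, d])
     ((\sum_(k < m)
         ((- (m%:R * beta * r `^ eta)) ^+ k / k`!%:R *
          derive1n k (LI lam a P sigma2 eta h d m) (m%:R * beta * r `^ eta)))
      * r * theta Rad Rmse (Num.sqrt (r ^+ 2 - h ^+ 2)))%R%:E.
Proof.
have [mix [mixL mixB ->]] := interference_law_exists.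
have mB : measurable B by exact: measurable_itv.
have mixfin : mix B < +oo.
  have := fin_num_measure mix B mB.
  by rewrite ge0_fin_numE.
have mvB : measurable_fun B v by exact: measurable_funTS.
(* As [v y = y / P + sigma2 / P], the noise factor of [LI] is merged into the exponential of the
   interference. *)
have LIE (s : R) : (0 < s)%R -> LI lam a P sigma2 eta h d m s = laplace_moment mix B v 0 s.
  move=> s0; rewrite LI_expR//.
  have e0 z : 0 <= (v z ^+ 0 * expR (- (s * v z)))%R%:E by rewrite expr0 mul1r lee_fin expR_ge0.
  have me : measurable_fun [set: R] (fun z => (v z ^+ 0 * expR (- (s * v z)))%R%:E).
    apply/measurable_EFinP; apply: measurable_funM => //.
    apply: (measurableT_comp (@measurable_expR R)).
    by apply: measurableT_comp => //; exact: measurable_funM.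
  rewrite /laplace_moment /Rintegral -(mixB _ me e0).
  transitivity (fine ((expR (- (s * sigma2 / P)))%:E * \int[mix]_z (expR (- (s * (z / P))))%:E)).
    by rewrite mixL ?(ltW s0).
  congr fine; rewrite -ge0_integralZl//; try exact: mexp;
    try (by move=> z _; rewrite lee_fin expR_ge0); try by rewrite lee_fin expR_ge0.
  apply: eq_integral => z _; rewrite -EFinM -expRD expr0 mul1r; congr (expR _)%:E.
  by rewrite /v; field; rewrite gt_eqF.
have dLI k (s : R) : (0 < s)%R ->
    derive1n k (LI lam a P sigma2 eta h d m) s = ((-1) ^+ k * laplace_moment mix B v k s)%R.
  move=> s0; exact: (@derive1n_laplace _ (measurableTypeR R) R mix B v mB mixfin mvB v_ge0 _ LIE k s s0).
(* Cutting with an indicator makes [G] nonnegative on the whole plane, as Tonelli requires; [E y r]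
   could be negative for [y < 0]. *)
pose indB (y r : R) : \bar R := ((0 <= y) && ((h < r) && (r <= d)))%R%:R%:E.
pose G (y r : R) : \bar R := indB y r * ((E y r)%:E * (r * lens_angle h Rad Rmse r)%R%:E).
have G0 y r : 0 <= G y r.
  rewrite /G /indB; case: (boolP [&& (0 <= y)%R, (h < r)%R & (r <= d)%R]) => [/and3P[y0 hr _]|_];
    last by rewrite mul0e.
  rewrite mul1e mule_ge0// lee_fin.
    by apply: E_ge0; rewrite /B/= in_itv/= y0.
  by rewrite mulr_ge0 ?lens_angle_ge0// ltW// (lt_trans h0).
have mG : measurable_fun setT (fun q : R * R => G q.1 q.2).
  apply: emeasurable_funM.
    apply: measurable_boolr_EFin; apply: measurable_and.
      exact: measurable_fun_ler.
    by apply: measurable_and; [exact: measurable_fun_ltr|exact: measurable_fun_ler].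
  apply: emeasurable_funM; apply/measurable_EFinP.
    apply: measurable_erlang_tail_comp; apply: measurable_funM.
      apply: measurable_funM => //.
      exact: (measurableT_comp (@measurable_powR R eta)).
    exact: (measurableT_comp mv).
  apply: measurable_funM => //.
  exact: (measurableT_comp (@measurable_lens_angle R h Rad Rmse)).
pose J (r : R) := \int[mix]_y G y r.
have mJ : measurable_fun [set: R] J.
  exact: (@measurable_fun_fubini_tonelli_G _ _ (measurableTypeR R) (measurableTypeR R) R mix
    (fun q => G q.1 q.2) mG (fun q => G0 q.1 q.2)).
have Psi0 z : 0 <= Psi z.
  by apply: integral_ge0 => p _; rewrite mule_ge0 ?lee_fin.
rewrite mixB//; last exact: (@measurable_mean R w mw w0 Phi mPhi Phi0).
transitivity (c%:E * \int[mu]_r J r).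
  transitivity (\int[mix]_y (c%:E * \int[mu]_r G y r)).
    rewrite integral_mkcond; apply: eq_integral => y _.
    rewrite patchE mem_setE in_itv/= andbT; case: ifPn => [y0|yn].
      rewrite /Psi mean_success// integral_mkcond; congr (_ * _).
      apply: eq_integral => r _; rewrite patchE mem_setE in_itv/= /G /indB y0/=.
      by case: ifPn; rewrite ?mul1e ?mul0e.
    by rewrite integral0_eq ?mule0// => r _; rewrite /G /indB (negbTE yn) mul0e.
  have mGi : measurable_fun [set: R] (fun y => \int[mu]_r G y r).
    exact: (@measurable_fun_fubini_tonelli_F _ _ (measurableTypeR R) (measurableTypeR R) R mu
      (fun q => G q.1 q.2) mG (fun q => G0 q.1 q.2)).
  have Gi0 y : 0 <= \int[mu]_r G y r by exact: integral_ge0.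
  rewrite ge0_integralZl//; try exact: mGi; try (by move=> y _; exact: Gi0).
  congr (_ * _).
  exact: (@fubini_tonelli _ _ (measurableTypeR R) (measurableTypeR R) R mix mu
    (fun q => G q.1 q.2) mG (fun q => G0 q.1 q.2)).
set f := (X in _ = _ * \int[_]_(r in _) (X r)%:E).
have Jf (r : R) : (h < r)%R -> (r <= d)%R -> J r = (f r)%:E.
  move=> hr rd.
  have r0 : (0 < r)%R by exact: lt_trans hr.
  (* With this [s] the argument of the Erlang tail satisfies [m t = s v y], so its terms become the
     integrands of [laplace_moment]. *)
  pose s := (m%:R * beta * r `^ eta)%R.
  have s0 : (0 < s)%R by rewrite !mulr_gt0// powR_gt0.
  have lm k : \int[mix]_(y in B) (v y ^+ k * expR (- (s * v y)))%R%:E =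
      (laplace_moment mix B v k s)%:E.
    rewrite /laplace_moment /Rintegral fineK//; apply: integrable_fin_num => //.
    exact: integrable_laplace.
  have EB : \int[mix]_(y in B) (E y r)%:E =
      (\sum_(k < m) (s ^+ k / k`!%:R * laplace_moment mix B v k s))%R%:E.
    transitivity (\int[mix]_(y in B) (\sum_(k < m) ((s ^+ k / k`!%:R)%:E *
        (v y ^+ k * expR (- (s * v y)))%R%:E))).
      apply: eq_integral => y _; rewrite /E /erlang_tail -sumEFin; apply: eq_bigr => k _.
      rewrite -EFinM; congr EFin.
      have -> : (m%:R * (beta * r `^ eta * v y) = s * v y)%R by rewrite /s !mulrA.
      by rewrite exprMn; ring.
    have mvk (k : nat) : measurable_fun B (fun y => (v y ^+ k * expR (- (s * v y)))%R%:E).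
      apply/measurable_EFinP; apply: measurable_funTS.
      apply: measurable_funM; first exact: measurable_funX.
      apply: (measurableT_comp (@measurable_expR R)).
      by apply: measurableT_comp => //; exact: measurable_funM.
    have vk0 (k : nat) y : B y -> 0 <= (v y ^+ k * expR (- (s * v y)))%R%:E.
      by move=> By; rewrite lee_fin mulr_ge0 ?expR_ge0// exprn_ge0// v_ge0.
    have sk0 (k : nat) : 0 <= (s ^+ k / k`!%:R)%:E by rewrite lee_fin divr_ge0// exprn_ge0// ltW.
    rewrite ge0_integral_sum//; last 2 first.
    - by move=> k; apply: emeasurable_funM => //; exact: mvk.
    - by move=> k y By; rewrite mule_ge0// vk0.
    rewrite -sumEFin; apply: eq_bigr => k _.
    by rewrite ge0_integralZl ?lm//; [exact: mvk|move=> y By; exact: vk0].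
  have -> : J r = \int[mix]_(y in B) ((E y r)%:E * (r * lens_angle h Rad Rmse r)%R%:E).
    rewrite [RHS]integral_mkcond; apply: eq_integral => y _.
    rewrite patchE mem_setE in_itv/= andbT /G /indB hr rd/= andbT.
    by case: ifPn; rewrite ?mul1e ?mul0e.
  have rl0 : 0 <= (r * lens_angle h Rad Rmse r)%R%:E.
    by rewrite lee_fin mulr_ge0 ?lens_angle_ge0// ltW.
  have mEr : measurable_fun B (fun y => (E y r)%:E).
    apply: measurable_funTS; apply/measurable_EFinP.
    by apply: measurable_erlang_tail_comp; exact: measurable_funM.
  rewrite ge0_integralZr//; last by move=> y By; rewrite lee_fin E_ge0.
  rewrite EB -EFinM /f theta_lens_angle// -mulrA; congr (_ * _)%:E.
  apply: eq_bigr => k _; rewrite -/s dLI// (exprNn s).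
  (* The sign of the [k]-th derivative cancels the sign of [(- s)^k]. *)
  have : ((-1) ^+ k * (-1) ^+ k = 1 :> R)%R by rewrite -exprMn mulrNN mulr1 expr1n.
  move: ((-1) ^+ k)%R (s ^+ k)%R (laplace_moment _ _ _ _ _) (k`!%:R^-1)%R => x A C D xx.
  by transitivity (x * x * (A * D * C))%R; [rewrite xx mul1r|ring].
(* The point [r = h], where [theta] and [lens_angle] may differ, is dropped as a null set.
   Measurability of the integrand is inherited from [J], with which it agrees on the half-open
   interval. *)
rewrite -integral_itv_obnd_cbnd; last first.
  apply: (@eq_measurable_fun _ _ (measurableTypeR R) (\bar R) `]h, d]%classic J).
    by move=> r; rewrite inE/= in_itv/= => /andP[hr rd]; exact: Jf.
  exact: measurable_funTS.
congr (_ * _); rewrite [RHS]integral_mkcond; apply: eq_integral => r _.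
rewrite patchE mem_setE in_itv/=; case: ifPn => [/andP[hr rd]|rn]; first exact: Jf.
by rewrite /J integral0_eq// => y _; rewrite /G /indB (negbTE rn) andbF mul0e.
Qed.

End assembly.

Unset Implicit Arguments.

Theorem theorem2 (R : realType) (lam a P sigma2 eta h Rad Rmse beta : R)
    (m : nat) (cmu cmse : R * R) :
  0 < lam -> 0 < a -> a <= 1 -> 0 < P -> 0 < sigma2 -> 2 < eta ->
  0 < h -> 0 < Rad -> 0 < Rmse -> 1 <= beta -> (0 < m)%N ->
  dist2 cmse cmu = Rad ->
  let d := Num.sqrt (h ^+ 2 + Rad ^+ 2) in
  ppp_disk_expect (a * lam) cmu Rad m
    (success_count P sigma2 eta h beta cmu Rad cmse Rmse) =
  ((a * lam)%:E *
   \int[lebesgue_measure]_(r in `[h, d])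
     ((\sum_(k < m)
         ((- (m%:R * beta * r `^ eta)) ^+ k / k`!%:R *
          derive1n k (LI lam a P sigma2 eta h d m) (m%:R * beta * r `^ eta)))
      * r * theta Rad Rmse (Num.sqrt (r ^+ 2 - h ^+ 2)))%:E)%E.
Proof.
move=> lam0 a0 _ P0 sigma20 _ h0 Rad0 Rmse0 beta1 m0 cc d.
exact: success_probability lam0 a0 P0 sigma20 h0 Rad0 Rmse0 (lt_le_trans ltr01 beta1) m0 cc.
Qed.
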